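(* Let $X$ be an $\ell_1$-predual, i.e. a real Banach space whose dual $X^*$ is isometric to $\ell_1$ (and identify $X^*$ with $\ell_1$). Then $X$ contains an isometric copy of a space $A(S)$ of affine continuous functions on a Choquet simplex $S$ if and only if there exist $g^*\in(\operatorname{ext} B_{\ell_1})'$ and $\bar x\in S_X$ such that $|g^*(\bar x)|=\|g^*\|=1$.
   Context: All spaces are real. $B_Z$ and $S_Z$ are the closed unit ball and unit sphere of a Banach space $Z$; $\operatorname{ext} K$ is the set of extreme points of a convex set $K$. For $A\subseteq X^*=\ell_1$, $A'$ denotes the set of $\sigma(X^*,X)$-cluster points of $A$, where $\sigma(X^*,X)$ is the weak* topology on $X^*$ induced by $X$. For a (compact) Choquet simplex $S$, $A(S)$ is the Banach space of affine continuous real-valued functions on $S$ with the sup norm.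
   Formalization: The space A(S) is required to be infinite-dimensional; as literally stated the claim fails for X = c_0 with S a single point, since A(S) = R embeds in c_0 while the only weak* cluster point of ext B_{l1} is 0. *)

(* Defs.v *)
From HB Require Import structures.
From mathcomp Require Import all_boot all_order all_algebra.
From mathcomp Require Import all_classical all_reals all_analysis.

Set Implicit Arguments.
Unset Strict Implicit.
Unset Printing Implicit Defensive.

Import Order.TTheory GRing.Theory Num.Theory.
Import numFieldNormedType.Exports.

Local Open Scope classical_set_scope.
Local Open Scope ring_scope.

Lemma sup_normD (R : realType) (T : Type) (D : set T) (f g : T -> R) :
  has_ubound [set `|f x| | x in D] -> has_ubound [set `|g x| | x in D] ->
  sup [set `|f x + g x| | x in D] <=
  sup [set `|f x| | x in D] + sup [set `|g x| | x in D].
Proof.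
move=> bf bg; have [->|/set0P [x0 Dx0]] := eqVneq D set0.
  by rewrite !image_set0 !sup0 addr0.
apply: ge_sup; first by exists `|f x0 + g x0|, x0.
move=> _ [x Dx <-]; apply: le_trans (ler_normD _ _) _.
by apply: lerD; apply: ub_le_sup => //; exists x.
Qed.

Lemma sup_normZ (R : realType) (T : Type) (D : set T) (a : R) (f : T -> R) :
  has_ubound [set `|f x| | x in D] ->
  sup [set `|a * f x| | x in D] = `|a| * sup [set `|f x| | x in D].
Proof.
move=> bf; have [->|/set0P [x0 Dx0]] := eqVneq D set0.
  by rewrite !image_set0 !sup0 mulr0.
have [->|a0] := eqVneq a 0.
  rewrite normr0 mul0r (_ : [set _ | _ in _] = [set 0]) ?sup1//.
  apply/seteqP; split=> [_ [x _ <-]|_ ->]; first by rewrite mul0r normr0.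
  by exists x0; rewrite ?mul0r ?normr0.
have a_gt0 : 0 < `|a| by rewrite normr_gt0.
apply/eqP; rewrite eq_le; apply/andP; split.
  apply: ge_sup; first by exists `|a * f x0|, x0.
  move=> _ [x Dx <-]; rewrite normrM ler_pM2l//.
  by apply: ub_le_sup => //; exists x.
rewrite -ler_pdivlMl//; apply: ge_sup; first by exists `|f x0|, x0.
move=> _ [x Dx <-]; rewrite ler_pdivlMl// -normrM; apply: ub_le_sup.
  case: bf => M bM; exists (`|a| * M) => _ [y Dy <-].
  by rewrite normrM ler_pM2l//; apply: bM; exists y.
by exists x.
Qed.

Lemma sup_norm0 (R : realType) (T : Type) (D : set T) (f : T -> R) x :
  has_ubound [set `|f x| | x in D] -> sup [set `|f x| | x in D] = 0 ->
  D x -> f x = 0.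
Proof.
move=> bf f0 Dx; apply/normr0_eq0/le_anti; rewrite normr_ge0 andbT -f0.
by apply: ub_le_sup => //; exists x.
Qed.

Lemma continuous_lin (R : realType) (T : topologicalType) (a : R)
    (f g : T -> R^o) :
  continuous f -> continuous g -> continuous (fun x => a *: f x + g x).
Proof.
move=> cf cg x; apply: (@cvgD _ R^o _ _ _ (fun x => a *: f x) g); last exact: cg.
by apply: (@cvgZ _ R^o _ _ _ (fun=> a) f); [exact: cvg_cst|exact: cf].
Qed.

Section ell1.
Context {R : realType}.

Definition l1_pred : {pred nat -> R^o} :=
  [pred f : nat -> R^o | (\sum_(n <oo) `|f n|%:E < +oo)%E].

Record l1 := L1 { l1_val :> nat -> R^o ; l1_valP : l1_val \in l1_pred }.

HB.instance Definition _ := [isSub for l1_val].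
HB.instance Definition _ := [Choice of l1 by <:].

Fact l1_submod_closed : submod_closed l1_pred.
Proof.
split=> [|a f g]; rewrite !inE /=.
  by rewrite eseries0// => n _ _; rewrite /= normr0.
move=> f1 g1.
apply: (@le_lt_trans _ _ (\sum_(n <oo) (`|a|%:E * `|f n|%:E + `|g n|%:E))%E).
  apply: lee_nneseries => [n _ _|n _]; first by rewrite lee_fin.
  rewrite -EFinM -EFinD lee_fin; apply: le_trans (ler_normD _ _) _.
  by rewrite normrM.
rewrite nneseriesD; [|by move=> n _ _; rewrite -EFinM lee_fin mulr_ge0|
  by move=> n _ _; rewrite lee_fin].
rewrite nneseriesZl; last by move=> n _; rewrite lee_fin.
apply: lte_add_pinfty => //.
by apply: lte_mul_pinfty => //; rewrite lee_fin.
Qed.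

HB.instance Definition _ :=
  GRing.isSubmodClosed.Build R (nat -> R^o) l1_pred l1_submod_closed.
HB.instance Definition _ := [SubChoice_isSubLmodule of l1 by <:].

Definition l1_norm (f : l1) : R := fine (\sum_(n <oo) `|f n|%:E)%E.

Let l1_fin (f : l1) : (\sum_(n <oo) `|f n|%:E)%E \is a fin_num.
Proof.
rewrite ge0_fin_numE; first by have := l1_valP f; rewrite inE.
by apply: nneseries_ge0 => n _ _; rewrite lee_fin.
Qed.

Fact l1_normD (f g : l1) : l1_norm (f + g) <= l1_norm f + l1_norm g.
Proof.
rewrite -lee_fin EFinD !fineK ?l1_fin// -nneseriesD; last 2 first.
- by move=> n _ _; rewrite lee_fin.
- by move=> n _ _; rewrite lee_fin.
apply: lee_nneseries => [n _ _|n _]; first by rewrite lee_fin.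
by rewrite -EFinD lee_fin ler_normD.
Qed.

Fact l1_normZ (a : R) (f : l1) : l1_norm (a *: f) = `|a| * l1_norm f.
Proof.
apply: EFin_inj; rewrite EFinM !fineK ?l1_fin// -nneseriesZl; last first.
  by move=> n _; rewrite lee_fin.
by apply: eq_eseriesr => n _; rewrite -EFinM -normrM.
Qed.

Fact l1_norm0 (f : l1) : l1_norm f = 0 -> f = 0.
Proof.
move=> f0; apply/val_inj/funext => n /=; apply/normr0_eq0/le_anti.
rewrite normr_ge0 andbT -f0 -lee_fin fineK ?l1_fin//.
rewrite (nneseriesD1 (n := n))//.
by apply: leeDl; apply: nneseries_ge0 => k _ _; rewrite lee_fin.
Qed.

HB.instance Definition _ :=
  Lmodule_isNormed.Build R l1 l1_normD l1_normZ l1_norm0.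

End ell1.
Arguments l1 : clear implicits.

Section dual_space.
Context {R : realType} (X : normedModType R).

Definition dual_pred : {pred X -> R^o} :=
  [pred f : X -> R^o | `[< linear f /\ continuous f >]].

Record dual := Dual { dual_val :> X -> R^o ; dual_valP : dual_val \in dual_pred }.

HB.instance Definition _ := [isSub for dual_val].
HB.instance Definition _ := [Choice of dual by <:].

Fact dual_submod_closed : submod_closed dual_pred.
Proof.
split=> [|a f g]; rewrite !inE.
  split=> [b x y|]; first by rewrite /= scaler0 addr0.
  exact: cst_continuous.
move=> [linf cf] [ling cg]; split=> [b x y|x].
  rewrite /= !fctE linf ling !scalerDr !scalerA mulrC addrACA.
  by congr (_ + _ + _).
exact: (continuous_lin cf cg).
Qed.

HB.instance Definition _ :=
  GRing.isSubmodClosed.Build R (X -> R^o) dual_pred dual_submod_closed.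
HB.instance Definition _ := [SubChoice_isSubLmodule of dual by <:].

Definition dual_norm (f : dual) : R := sup [set `|f x| | x in [set x | `|x| <= 1]].

Let dual_linear (f : dual) : linear f.
Proof. by have := dual_valP f; rewrite inE => -[]. Qed.

Let dual_bounded (f : dual) : has_ubound [set `|f x| | x in [set x | `|x| <= 1]].
Proof.
have cf : continuous f by have := dual_valP f; rewrite inE => -[].
pose h : {linear X -> R^o} := HB.pack (f : X -> R^o)
  (GRing.isLinear.Build _ _ _ _ (f : X -> R^o) (dual_linear f)).
have /bounded_funP /(_ 1) [M bM] : bounded_near h (nbhs (0 : X)).
  by apply: (@continuous_linear_bounded _ _ _ _ h); exact: cf.
by exists M => _ [x /= x1 <-]; exact: bM.
Qed.

Fact dual_normD (f g : dual) : dual_norm (f + g) <= dual_norm f + dual_norm g.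
Proof. by apply: sup_normD; exact: dual_bounded. Qed.

Fact dual_normZ (a : R) (f : dual) : dual_norm (a *: f) = `|a| * dual_norm f.
Proof. by apply: sup_normZ; exact: dual_bounded. Qed.

Fact dual_norm0 (f : dual) : dual_norm f = 0 -> f = 0.
Proof.
move=> f0; apply/val_inj/funext => x /=.
have fZ a y : f (a *: y) = a * f y.
  have f00 : f 0 = 0.
    have := dual_linear f 1 0 0; rewrite scaler0 addr0 scale1r => /eqP.
    by rewrite -[X in X == _]addr0 (inj_eq (addrI _)) => /eqP.
  by rewrite -[a *: y]addr0 dual_linear f00 addr0.
have [->|x0] := eqVneq x 0; first by rewrite -(scale0r 0) fZ mul0r.
have nx : `|x| != 0 by rewrite normr_eq0.
rewrite -[x in LHS](scale1r) -(divff nx) -scalerA fZ.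
rewrite (sup_norm0 (dual_bounded f) f0) ?mulr0//=.
by rewrite normrZ normfV normr_id mulVf.
Qed.

HB.instance Definition _ :=
  Lmodule_isNormed.Build R dual dual_normD dual_normZ dual_norm0.

End dual_space.

Section convexity.
Context {R : realType}.

Definition extreme_points (V : lmodType R) (K : set V) : set V :=
  [set x | K x /\ forall (y z : V) (t : R), K y -> K z -> 0 < t < 1 ->
    x = t *: y + (1 - t) *: z -> y = x /\ z = x].

Definition lattice_ordered (V : Type) (D : set V) (le : V -> V -> Prop) :=
  forall u v, D u -> D v ->
    (exists w, [/\ D w, le u w, le v w &
       forall w', D w' -> le u w' -> le v w' -> le w w']) /\
    (exists w, [/\ D w, le w u, le w v &
       forall w', D w' -> le w' u -> le w' v -> le w' w]).

Section cone.
Variables (E : lmodType R) (S : set E).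

(* The cone of base [S `*` [set 1]], which lies in a hyperplane missing 0 even
   when [S] itself does not. *)
Definition base_cone : set (E * R^o) :=
  [set u | 0 <= u.2 /\ exists2 x, S x & u.1 = u.2 *: x].

Definition cone_le (u v : E * R^o) : Prop := base_cone (v - u).

Definition cone_span : set (E * R^o) :=
  [set w | exists u v, [/\ base_cone u, base_cone v & w = u - v]].

Definition simplex : Prop := lattice_ordered cone_span cone_le.

End cone.

Record choquet_simplex := ChoquetSimplex {
  cs_space : tvsType R ;
  cs_set :> set cs_space ;
  cs_hausdorff : hausdorff_space cs_space ;
  cs_nonempty : cs_set !=set0 ;
  cs_compact : compact cs_set ;
  cs_convex : convex_set cs_set ;
  cs_simplex : simplex cs_set }.

End convexity.
Arguments choquet_simplex : clear implicits.

Section affine_functions.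
Context {R : realType} (S : choquet_simplex R).

(* Stated through the inclusion [set_val], as [S] is a subtype of the ambient
   space that has no convex combinations of its own. *)
Definition affine_on (f : S -> R) : Prop :=
  forall (x y z : S) (t : R), 0 <= t <= 1 ->
    set_val z = t *: set_val x + (1 - t) *: set_val y ->
    f z = t * f x + (1 - t) * f y.

Definition affine_pred : {pred S -> R^o} :=
  [pred f : S -> R^o | `[< affine_on f /\ continuous f >]].

Record affine_space :=
  Affine { affine_val :> S -> R^o ; affine_valP : affine_val \in affine_pred }.

HB.instance Definition _ := [isSub for affine_val].
HB.instance Definition _ := [Choice of affine_space by <:].

Fact affine_submod_closed : submod_closed affine_pred.
Proof.
split=> [|a f g]; rewrite !inE.
  split=> [x y z t _ _|]; first by rewrite /= !mulr0 addr0.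
  exact: cst_continuous.
move=> [aff cf] [afg cg]; split=> [x y z t t01 e|x].
  rewrite /= !fctE (aff _ _ _ _ t01 e) (afg _ _ _ _ t01 e).
  rewrite /GRing.scale/= !mulrDr !mulrA [a * t]mulrC [a * (1 - t)]mulrC.
  by rewrite addrACA.
exact: (continuous_lin cf cg).
Qed.

HB.instance Definition _ :=
  GRing.isSubmodClosed.Build R (S -> R^o) affine_pred affine_submod_closed.
HB.instance Definition _ := [SubChoice_isSubLmodule of affine_space by <:].

Definition affine_norm (f : affine_space) : R := sup [set `|f x| | x in setT].

Let affine_bounded (f : affine_space) : has_ubound [set `|f x| | x in setT].
Proof.
have cf : continuous f by have := affine_valP f; rewrite inE => -[].
have cS : compact (valL (f : S -> R^o) @` S).
  by apply: continuous_compact (@cs_compact _ S); exact/subspace_valL_continuousP.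
have /pinfty_ex_gt0 [M _ bM] := compact_bounded cS.
exists M => _ [x _ <-]; apply: bM; exists (set_val x); first exact: set_valP.
exact: (congr1 (@^~ x) (valLK point (f : S -> R^o))).
Qed.

Fact affine_normD (f g : affine_space) :
  affine_norm (f + g) <= affine_norm f + affine_norm g.
Proof. by apply: sup_normD; exact: affine_bounded. Qed.

Fact affine_normZ (a : R) (f : affine_space) :
  affine_norm (a *: f) = `|a| * affine_norm f.
Proof. by apply: sup_normZ; exact: affine_bounded. Qed.

Fact affine_norm0 (f : affine_space) : affine_norm f = 0 -> f = 0.
Proof.
move=> f0; apply/val_inj/funext => x.
exact: (sup_norm0 (affine_bounded f) f0).
Qed.

HB.instance Definition _ :=
  Lmodule_isNormed.Build R affine_space affine_normD affine_normZ affine_norm0.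

End affine_functions.

Section isometries.
Context {R : realType}.

Definition finite_dimensional (V : lmodType R) : Prop :=
  exists (n : nat) (e : 'I_n -> V),
    forall v, exists c : 'I_n -> R, v = \sum_(i < n) c i *: e i.

Definition isometric_embedding (V W : normedModType R) (T : {linear V -> W}) : Prop :=
  forall v, `|T v| = `|v|.

Definition isometric_isomorphism (V W : normedModType R) (T : {linear V -> W}) : Prop :=
  isometric_embedding T /\ forall w, exists v, T v = w.

Definition contains_isometric_copy (X V : normedModType R) : Prop :=
  exists T : {linear V -> X}, isometric_embedding T.

End isometries.

Section weak_star_topology.
Context {R : realType} (X : normedModType R).

(* sigma(X^*, X) transported to ell_1 along an identification of ell_1 with X^*:
   the topology of pointwise convergence on [X]. *)
Definition weak_star (iota : l1 R -> dual X) : Type :=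
  initial_topology ((fun g : l1 R => iota g : X -> R) : l1 R -> {ptws X -> R}).

HB.instance Definition _ (iota : l1 R -> dual X) := Topological.on (weak_star iota).

Definition weak_star_derived (iota : l1 R -> dual X) (A : set (l1 R)) : set (l1 R) :=
  limit_point (A : set (weak_star iota)).

End weak_star_topology.

(* Main.v *)
Require Import Defs.
From HB Require Import structures.
From mathcomp Require Import all_boot all_order all_algebra.
From mathcomp Require Import all_classical all_reals all_analysis.
From mathcomp Require Import ring lra.
Import Order.TTheory GRing.Theory Num.Theory.
Import numFieldNormedType.Exports.
Local Open Scope classical_set_scope.
Local Open Scope ring_scope.

Set Implicit Arguments.
Unset Strict Implicit.

(* Write [e_n] for the [n]-th coordinate functional on [X]; the extreme points
   of the dual ball are the [+-e_n], and both conditions of the theorem are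
   equivalent to the existence of [x0] in the unit ball of [X] such that
   [|e_n(x0)| = 1] for infinitely many [n].

   If [T] embeds an infinite-dimensional [A(S)], take [x0 = T 1]: for [h >= 0]
   the norm [1 + |h|] of [T (1 + h)] is attained at some [e_n], where then
   [|e_n(x0)| = 1]; finitely many such [n] would make [A(S)]
   finite-dimensional.  By Tychonoff, infinitely many signed coordinates with
   value 1 at [x0] have a weak* cluster point [g], and [g(x0) = 1].

   Conversely, the main tool is a ball intersection property: finitely many
   pairwise intersecting balls of [X] have a common point with any prescribed,
   pointwise admissible, values of finitely many coordinates.  It follows from
   Hahn-Banach in a finite power of [X], since a separating family of elements
   of [ell_1] is harmless coordinate by coordinate.  Given [g] and [x] with
   [g(x) = 1], either [|e_n(x)| = 1] infinitely often, or [g] is supported by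
   the finitely many coordinates of modulus 1 and [x] can be corrected
   inductively to reach the value 1 at infinitely many coordinates close to
   [g].  From the resulting [x0], the ball property builds nested copies of
   [ell_infty^(n+1)] in [X] whose unit vector bases are partitions of [x0].
   The closure of their union is [A(S)], where [S] is the inverse limit of the
   corresponding finite-dimensional simplices. *)

(** * Dependent choice, finite families of linear forms, intervals of the line *)

Definition linear_of (R : pzRingType) (V W : lmodType R) (f : V -> W)
    (lf : linear f) : {linear V -> W} :=
  HB.pack f (GRing.isLinear.Build _ _ _ _ f lf).

(** Dependent choice. The recursion runs over states bundled with a proof of the invariant [P n],
    since only such states have a successor. *)
Lemma sequence_choice (T : Type) (P : nat -> T -> Prop)
    (Q : nat -> T -> T -> Prop) (x0 : T) : P 0%N x0 ->
  (forall n x, P n x -> exists2 y, P n.+1 y & Q n x y) ->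
  exists u : nat -> T, [/\ u 0%N = x0, forall n, P n (u n) &
    forall n, Q n (u n) (u n.+1)].
Proof.
move=> P0 PS.
pose step n (s : {x | P n x}) : {x | P n.+1 x} :=
  let h := cid2 (PS n (sval s) (svalP s)) in exist _ (s2val h) (s2valP h).
pose s := nat_rect (fun n => {x | P n x}) (exist _ x0 P0) step.
exists (fun n => sval (s n)); split=> // n; first exact: svalP.
by rewrite /= /step; case: cid2.
Qed.

(** The increments form a series dominated by a geometric one, hence absolutely convergent in the
    complete space [V]. *)
Lemma cvgn_geometric_step (R : realType) (V : completeNormedModType R)
    (u : nat -> V) (C : R) :
  (forall n, `|u n.+1 - u n| <= C * 2^-1 ^+ n) -> cvgn u.
Proof.
move=> uC.
have /normed_cvg cu : cvgn [normed series (telescope u)].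
  apply: (@series_le_cvg _ _ (geometric C 2^-1)).
  - by move=> n /=.
  - by move=> n; rewrite /geometric /=; apply: le_trans (uC n).
  - by move=> n; exact: uC.
  - by apply: is_cvg_geometric_series; rewrite ger0_norm// invf_lt1// ltr1n.
rewrite (_ : u = fun n => u 0%N + series (telescope u) n).
  exact: is_cvgD (is_cvg_cst _) cu.
by apply/funext => n; exact: eq_sum_telescope.
Qed.

(** Induction on [s]. If [e i] vanishes on the common kernel of the other forms, it gets the
    coefficient 0; otherwise a vector [z] of that kernel with [e i z != 0] dictates the coefficient
    [f z / e i z]. *)
Lemma linear_form_span (R : realType) (V : lmodType R) (I : eqType)
    (e : I -> {linear V -> R^o}) (s : seq I) (f : {linear V -> R^o}) :
  uniq s -> (forall x, (forall i, i \in s -> e i x = 0) -> f x = 0) ->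
  exists c : I -> R, forall x, f x = \sum_(i <- s) c i * e i x.
Proof.
elim: s f => [f _ f0|i s IHs f /= /andP[ins us]].
  by exists (fun=> 0) => x; rewrite big_nil f0.
move=> f0; have [[z zs zi]|] := pselect (exists2 z,
    (forall j, j \in s -> e j z = 0) & e i z != 0); last first.
  move=> /forall2NP noz; have [x xs|c cE] := IHs f us.
    apply: f0 => j; rewrite inE => /predU1P[->|/xs//].
    by have [/(_ xs)//|/negP/negPn/eqP] := noz x.
  exists (fun j => if j == i then 0 else c j) => x.
  rewrite big_cons eqxx mul0r add0r cE !big_seq; apply: eq_bigr => j js.
  by case: eqP => // ji; rewrite -ji js in ins.
pose a := f z / e i z.
have lg : linear (fun x => f x - a * e i x : R^o).
  move=> b x y; rewrite !linearP/= /GRing.scale/= ; ring.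
have [x xs|c cE] := IHs (linear_of lg) us.
  have lin (g : {linear V -> R^o}) b y w : g (y - b *: w) = g y - b * g w.
    by rewrite linearB linearZ.
  have := f0 (x - (e i x / e i z) *: z); rewrite lin => h.
  have {}h : f x - e i x / e i z * f z = 0.
    apply: h => j; rewrite inE lin => /predU1P[->|js].
      by rewrite divfK// subrr.
    by rewrite (xs j js) (zs j js); ring.
  by rewrite -[LHS]/(f x - f z / e i z * e i x : R) -[RHS]h; ring.
exists (fun j => if j == i then a else c j) => x.
rewrite big_cons eqxx; have := cE x; rewrite /= => /eqP.
rewrite subr_eq => /eqP ->; rewrite addrC; congr (_ + _).
rewrite !big_seq; apply: eq_bigr => j js.
by case: eqP => // ji; rewrite -ji js in ins.
Qed.

(** The largest left end point exceeds no right end point, because the intervals meet pairwise. *)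
Lemma interval_helly (R : realType) (I : finType) (a r : I -> R) (i0 : I) :
  (forall i j, `|a i - a j| <= r i + r j) ->
  exists t, forall i, `|t - a i| <= r i.
Proof.
move=> ar; pose m := [arg max_(i > i0) (a i - r i)]%O.
exists (a m - r m); rewrite /m; case: arg_maxP => //= j _ jmax i;
  have := jmax i isT; have := ar i j.
by rewrite !ler_norml => /andP[]; lra.
Qed.

Lemma cvg_sumr (R : realType) (V : normedModType R) (T : Type)
    (F : set_system T) {FF : Filter F} (I : Type) (r : seq I) (P : pred I)
    (u : I -> T -> V) (l : I -> V) : (forall i, P i -> u i @ F --> l i) ->
  (fun t => \sum_(i <- r | P i) u i t) @ F --> \sum_(i <- r | P i) l i.
Proof. by move=> ul; apply: cvg_big => //; exact: add_continuous. Qed.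

(** Elimination: a finite list [L] is built such that every vector, corrected by a combination of
    [L], annihilates all forms in [s]. When the forms separate points, [L] spans. *)
Lemma finite_dimensional_of_forms (R : realType) (V : lmodType R)
    (phi : nat -> {linear V -> R^o}) (s : seq nat) :
  (forall v, (forall i, i \in s -> phi i v = 0) -> v = 0) ->
  finite_dimensional V.
Proof.
have [L LP] : exists L : seq V, forall v, exists c : nat -> R,
    forall i, i \in s -> phi i (v - \sum_(k < size L) c k *: L`_k) = 0.
  elim: s => [|i s [L LP]]; first by exists [::] => v; exists (fun=> 0).
  have [[z zs zi]|] := pselect (exists2 z,
      (forall j, j \in s -> phi j z = 0) & phi i z != 0); last first.
    move=> /forall2NP noz; exists L => v; have [c cP] := LP v; exists c => j.
    rewrite inE => /predU1P[->|]; last exact: cP.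
    apply/eqP; apply: contrapT => /negP h.
    by have [/(_ cP)|] := noz (v - \sum_(k < size L) c k *: L`_k).
  exists (z :: L) => v; have [c cP] := LP v.
  set w := v - _ in cP; pose b := phi i w / phi i z.
  (* The new vector [z] heads the list, so the old coefficients move up by one index; [b] cancels
     the form [phi i]. *)
  exists (fun k => if k is k'.+1 then c k' else b) => j js.
  rewrite big_ord_recl/= opprD addrA addrAC -/w linearB linearZ/=.
  move: js; rewrite inE => /predU1P[->|js].
    by rewrite -[X in _ - X]/(b * phi i z) divfK// subrr.
  by rewrite cP// zs// scaler0 subrr.
move=> ker0; exists (size L), (fun k => L`_k) => v; have [c cP] := LP v.
by exists (fun k => c k); apply/eqP; rewrite -subr_eq0; apply/eqP/ker0.
Qed.

(** * The Hahn-Banach theorem *)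

Section hahn_banach.
Context {R : realType} {V : lmodType R}.

(** Partial linear forms are coded by their graphs; single-valuedness follows from domination by a
    sublinear [p]. *)
Definition linear_graph (G : set (V * R^o)) :=
  G !=set0 /\ forall (a : R) u v, G u -> G v -> G (a *: u + v).

Definition dominated_graph (p : V -> R) (G : set (V * R^o)) :=
  forall v r, G (v, r) -> r <= p v.

Lemma linear_graph0 G : linear_graph G -> G 0.
Proof.
by move=> [[u Gu] GD]; have := GD (-1) _ _ Gu Gu; rewrite scaleN1r addNr.
Qed.

Lemma linear_graphZ G (a : R) u : linear_graph G -> G u -> G (a *: u).
Proof.
by move=> lG Gu; rewrite -[_ *: _]addr0; apply: lG.2 => //;
  exact: linear_graph0.
Qed.

Lemma linear_graphD G u v : linear_graph G -> G u -> G v -> G (u + v).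
Proof. by move=> lG Gu Gv; rewrite -[u]scale1r; exact: lG.2. Qed.

Variable p : V -> R.
Hypothesis pD : forall x y, p (x + y) <= p x + p y.
Hypothesis pZ : forall (t : R) x, 0 <= t -> p (t *: x) = t * p x.

(** The admissible values at [v0] lie between the numbers [u.2 - p (u.1 - v0)] and
    [p (w.1 + v0) - w.2]. Subadditivity keeps the former below the latter, and [c] is the supremum
    of the former. *)
Lemma dominated_graph_extend G v0 : linear_graph G -> dominated_graph p G ->
  exists c, let G' := [set w | exists t u, G u /\ w = t *: (v0, c) + u] in
    linear_graph G' /\ dominated_graph p G'.
Proof.
move=> lG dG.
pose A := [set w.2 - p (w.1 - v0) | w in G].
have AB u w : G u -> G w -> u.2 - p (u.1 - v0) <= p (w.1 + v0) - w.2.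
  move=> Gu Gw; have /dG /= := linear_graphD lG Gu Gw.
  have /= := pD (u.1 - v0) (w.1 + v0).
  by rewrite addrA [u.1 - v0 + _]addrAC subrK; lra.
have G0 := linear_graph0 lG.
have A0 : A !=set0 by exists (0 - p (0 - v0)), 0.
have ubA : has_ubound A by exists (p (0 + v0) - 0) => _ [u Gu <-];
  exact: (AB u 0).
exists (sup A); split.
  split; first by exists 0, 0, 0; split=> //; rewrite scale0r addr0.
  move=> a _ _ [t [u [Gu ->]]] [s [w [Gw ->]]].
  exists (a * t + s), (a *: u + w); split; first exact: lG.2.
  by rewrite scalerDr scalerA scalerDl addrACA.
move=> _ _ [t [[v r] [Gu [-> ->]]]]; rewrite /= -[_ *: sup A]/(t * sup A).
have [t0|t0|->] := ltgtP t 0; last by rewrite mul0r scale0r !add0r; exact: dG.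
- have /= := linear_graphZ (- t^-1) lG Gu => Gu'.
  have := ub_le_sup ubA (ex_intro2 _ _ _ Gu' erefl) => /= h.
  have {h} : - t * (- t^-1 * r - p (- t^-1 *: v - v0)) <= - t * sup A.
    by rewrite ler_pM2l ?oppr_gt0.
  rewrite mulrBr -pZ ?oppr_ge0 ?(ltW t0)// scalerBr.
  rewrite scalerA mulrA mulrNN divff ?lt_eqF// mul1r scale1r scaleNr opprK.
  by rewrite [v + _]addrC; lra.
- have /= := linear_graphZ (t^-1) lG Gu => Gu'.
  have : sup A <= p (t^-1 *: v + v0) - t^-1 * r.
    by apply: ge_sup => // _ [w Gw <-]; exact: (AB _ _ Gw Gu').
  rewrite -(ler_pM2l t0) mulrBr -pZ ?(ltW t0)// scalerDr scalerA mulrA.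
  by rewrite divff ?gt_eqF// mul1r scale1r [t *: v0 + v]addrC; lra.
Qed.

Lemma hahn_banach (G0 : set (V * R^o)) : linear_graph G0 ->
  dominated_graph p G0 ->
  exists f : {linear V -> R^o}, (forall v, f v <= p v) /\
    forall v r, G0 (v, r) -> f v = r.
Proof.
move=> lG0 dG0.
pose good G := linear_graph G /\ dominated_graph p G.
(* Zorn's lemma is applied to the sets whose union with [G0] is good, so that the empty chain is
   covered as well. *)
have [F FP Ftot|A [[lM dM] Amax]] := @Zorn_bigcup _ [set G | good (G `|` G0)].
  split.
    split; first by have [u Gu] := lG0.1; exists u; right.
    have FF X u v a : F X -> (X `|` G0) u -> (X `|` G0) v ->
        (\bigcup_(X in F) X `|` G0) (a *: u + v).
      move=> FX Xu Xv; have [lX _] := FP _ FX.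
      by case: (lX.2 a u v Xu Xv) => ?; [left; exists X|right].
    move=> a u v [[X FX Xu]|Gu] [[Y FY Yv]|Gv].
    - have [XY|YX] := Ftot _ _ FX FY.
        by apply: (FF Y) => //; left=> //; exact: XY.
      by apply: (FF X) => //; left=> //; exact: YX.
    - by apply: (FF X) => //; [left|right].
    - by apply: (FF Y) => //; [right|left].
    - by right; exact: lG0.2.
  move=> v r [[X FX Xu]|]; last exact: dG0.
  by have [_ dX] := FP _ FX; apply: dX; left.
set M := A `|` G0 in lM dM.
have tot v : exists r, M (v, r).
  have [c [lG' dG']] := dominated_graph_extend v lM dM.
  set G' := [set _ | _] in lG' dG'.
  have MG' : M `<=` G'.
    by move=> u Mu; exists 0, u; split=> //; rewrite scale0r add0r.
  have G'A : G' `<=` A.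
    apply: contrapT => nG'A; apply: (Amax G').
      by split=> //; apply: subset_trans MG'; exact: subsetUl.
    rewrite /mkset (_ : G' `|` G0 = G')//; apply/setUidPl.
    by apply: subset_trans MG'; exact: subsetUr.
  exists c; left; apply: G'A; exists 1, 0; split; first exact: linear_graph0.
  by rewrite scale1r addr0.
have p0 : p 0 = 0 by rewrite -(scale0r 0) pZ// mul0r.
have uniq v r s : M (v, r) -> M (v, s) -> r = s.
  have le r' s' : M (v, r') -> M (v, s') -> r' <= s'.
    move=> Mr Ms; have /dM := linear_graphD lM Mr (linear_graphZ (-1) lM Ms).
    by rewrite scaleN1r /= subrr p0 subr_le0.
  by move=> Mr Ms; apply/le_anti; rewrite !le.
pose f v := sval (cid (tot v)).
have Mf v : M (v, f v) by rewrite /f; case: cid.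
have flin : linear (f : V -> R^o).
  by move=> a u v; apply: uniq (Mf _) _; exact: (lM.2 a _ _ (Mf u) (Mf v)).
exists (linear_of flin); split=> [v|v r G0v]; first exact: dM (Mf v).
by apply: uniq (Mf v) _; right.
Qed.

End hahn_banach.

(** * Inverse limits of simplices *)

Section affine_basics.
Context {R : realType} {S : choquet_simplex R}.
Implicit Types f : affine_space S.

Lemma affine_continuous f : continuous (f : S -> R^o).
Proof. by have := affine_valP f; rewrite inE => -[]. Qed.

Lemma affine_has_ubound f : has_ubound [set `|f x| | x in [set: S]].
Proof.
have cS : compact (valL (f : S -> R^o) @` S).
  apply: continuous_compact (@cs_compact _ S).
  by apply/subspace_valL_continuousP; exact: affine_continuous.
have /pinfty_ex_gt0 [M _ bM] := compact_bounded cS.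
exists M => _ [x _ <-]; apply: bM; exists (set_val x); first exact: set_valP.
exact: (congr1 (@^~ x) (valLK point (f : S -> R^o))).
Qed.

Lemma affine_apply_le f x : `|f x| <= `|f|.
Proof. by apply: ub_le_sup; [exact: affine_has_ubound|exists x]. Qed.

Lemma choquet_simplex_point : exists x : S, True.
Proof. by have [x Sx] := @cs_nonempty R S; exists (exist _ x (mem_set Sx)). Qed.

Lemma affine_norm_le f (M : R) : (forall x, `|f x| <= M) -> `|f| <= M.
Proof.
move=> fM; have [x0 _] := choquet_simplex_point.
apply: ge_sup; first by exists `|f x0|, x0.
by move=> _ [x _ <-].
Qed.

End affine_basics.

(* [u n 0], ..., [u n n] is the unit vector basis of an isometric copy of
   $\ell_\infty^{n+1}$, which the convex weights [a n] embed in the next one. *)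
Definition linfty_tower (R : realType) (X : normedModType R)
    (a : nat -> nat -> R) (u : nat -> nat -> X) : Prop :=
  [/\ forall n k, (k <= n)%N -> 0 <= a n k,
      forall n, \sum_(k < n.+1) a n k = 1,
      forall n k, (k <= n)%N -> u n k = u n.+1 k + a n k *: u n.+1 n.+1,
      forall n (y : nat -> R) (M : R), 0 <= M ->
        (forall k, (k <= n)%N -> `|y k| <= M) ->
        `|\sum_(k < n.+1) y k *: u n k| <= M &
      forall n (y : nat -> R) l, (l <= n)%N ->
        `|y l| <= `|\sum_(k < n.+1) y k *: u n k|].

Lemma convex_setI01 (R : realType) (M : lmodType R) (A : set M) :
  (forall x y (t : R), A x -> A y -> 0 <= t <= 1 ->
    A (t *: x + (1 - t) *: y)) ->
  convex_set A.
Proof.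
move=> Acvx x y p; rewrite !inE => Ax Ay.
apply: (Acvx x y p%:inum Ax Ay).
by rewrite ge0 le1.
Qed.

Lemma convex_norm_lt (R : realType) (t e x y : R) : 0 <= t <= 1 ->
  `|x| < e -> `|y| < e -> `|t * x + (1 - t) * y| < e.
Proof.
move=> /andP[t0 t1] xe ye; apply: le_lt_trans (ler_normD _ _) _.
rewrite !normrM (ger0_norm t0) [`|1 - t|]ger0_norm ?subr_ge0//.
have [->|tn0] := eqVneq t 0; first by rewrite mul0r add0r subr0 mul1r.
have : t * `|x| < t * e by rewrite ltr_pM2l// lt_def tn0.
have : (1 - t) * `|y| <= (1 - t) * e by rewrite ler_wpM2l ?subr_ge0// ltW.
lra.
Qed.

(** * The locally convex space of real sequences *)

Definition real_seq (R : realType) : Type := nat -> R^o.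

Section real_seq.
Context {R : realType}.

HB.instance Definition _ := GRing.Lmodule.copy (real_seq R) (nat -> R^o).
HB.instance Definition _ := Uniform.copy (real_seq R) {ptws nat -> R^o}.

Lemma real_seq_cvgP (T : Type) (F : set_system T) {FF : Filter F}
    (f : T -> real_seq R) (l : real_seq R) :
  f @ F --> l <-> forall k, f t k @[t --> F] --> l k.
Proof. exact: (@pointwise_cvgP nat R^o (f @ F) l). Qed.

Lemma real_seq_eval_continuous k : continuous (fun b : real_seq R => b k : R^o).
Proof. by move=> b; have /real_seq_cvgP := @cvg_id _ (nbhs b); apply. Qed.

Definition cylinder (b : real_seq R) n (e : R) : set (real_seq R) :=
  [set c | forall k, (k < n)%N -> `|b k - c k| < e].

Lemma cylinder_open b n e : open (cylinder b n e).
Proof.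
elim: n => [|n IHn].
  by rewrite (_ : cylinder _ _ _ = setT); [exact: openT|apply/seteqP].
rewrite (_ : cylinder _ _ _ =
    cylinder b n e `&` (fun c => c n) @^-1` ball (b n) e).
  apply: openI => //; apply: open_comp; last exact: ball_open.
  by move=> c _; exact: real_seq_eval_continuous.
apply/seteqP; split=> [c bc|c [bc cn] k].
  by split=> [k kn|]; apply: bc; rewrite // ltnS ltnW.
by rewrite ltnS leq_eqVlt => /predU1P[->//|]; exact: bc.
Qed.

(** The filter generated by the cylinders around [b] converges to [b] coordinatewise, so it contains
    every neighbourhood of [b]. *)
Lemma nbhs_cylinder b (U : set (real_seq R)) : nbhs b U ->
  exists n e, 0 < e /\ cylinder b n e `<=` U.
Proof.
pose F := filter_from [set ne : nat * R | 0 < ne.2]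
  (fun ne => cylinder b ne.1 ne.2).
have FF : Filter F.
  apply: filter_from_filter; first by exists (0%N, 1) => /=.
  move=> [n e] [m d] /= e0 d0; exists (maxn n m, Num.min e d) => /=.
    by rewrite lt_min e0.
  move=> c bc; split=> k kn; have := bc k; rewrite lt_min leq_max.
    by rewrite kn => /(_ isT)/andP[].
  by rewrite kn orbT => /(_ isT)/andP[].
have Fb : id @ F --> b.
  apply/real_seq_cvgP => k; apply/cvgrPdist_lt => e e0.
  by exists (k.+1, e) => //= c; exact.
by move=> /Fb[[n e] /= e0 bU]; exists n, e.
Qed.

Lemma real_seq_add_continuous :
  continuous (fun bc : real_seq R * real_seq R => bc.1 + bc.2).
Proof.
move=> [b c]; apply/real_seq_cvgP => k.
apply: (@cvgD _ R^o _ _ _ (fun t : real_seq R * real_seq R => t.1 k)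
  (fun t : real_seq R * real_seq R => t.2 k)).
  by move: k; apply/real_seq_cvgP; exact: cvg_fst.
by move: k; apply/real_seq_cvgP; exact: cvg_snd.
Qed.

Lemma real_seq_scale_continuous :
  continuous (fun tb : R^o * real_seq R => tb.1 *: tb.2).
Proof.
move=> [t b]; apply/real_seq_cvgP => k.
apply: (@cvgZ _ R^o _ _ _ (fun t : R^o * real_seq R => t.1)
  (fun t : R^o * real_seq R => t.2 k)).
  exact: cvg_fst.
by move: k; apply/real_seq_cvgP; exact: cvg_snd.
Qed.

Lemma real_seq_locally_convex : exists2 B : set_system (real_seq R),
  (forall b, b \in B -> convex_set b) & basis B.
Proof.
exists [set A | exists b n e, A = cylinder b n e].
  move=> A; rewrite inE => -[b [n [e ->]]]; apply: convex_setI01.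
  move=> x y t bx yb /andP[t0 t1] k kn.
  have -> : b k - (t *: x + (1 - t) *: y) k =
      t * (b k - x k) + (1 - t) * (b k - y k).
    have E (p q r : R) : p - (t * q + (1 - t) * r) =
      t * (p - q) + (1 - t) * (p - r).
      by ring.
    exact: E.
  by apply: convex_norm_lt; [rewrite t0|exact: bx|exact: yb].
split; first by move=> _ [b [n [e ->]]]; exact: cylinder_open.
move=> b U /nbhs_cylinder[n [e [e0 bU]]]; exists (cylinder b n e) => //.
split; first by exists b, n, e.
by move=> k _; rewrite subrr normr0.
Qed.

HB.instance Definition _ := PreTopologicalNmodule_isTopologicalNmodule.Build
  (real_seq R) real_seq_add_continuous.
HB.instance Definition _ := TopologicalNmodule_isTopologicalLmodule.Build R
  (real_seq R) real_seq_scale_continuous.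
HB.instance Definition _ := Uniform_isTvs.Build R (real_seq R)
  real_seq_locally_convex.

End real_seq.

(** * The inverse limit of simplices: coordinates, compactness, lattice order *)

Section tower_simplex.
Context {R : realType}.
Variable a : nat -> nat -> R.
Hypothesis a_ge0 : forall n k, (k <= n)%N -> 0 <= a n k.
Hypothesis a_sum : forall n, \sum_(k < n.+1) a n k = 1.
Implicit Types b u v w : real_seq R.

(* A point [b] of the inverse limit is coded by the last barycentric coordinate
   [b n] of each level [n]; the other coordinates of level [n.+1] are determined
   by those of level [n].  The value is junk for [k > n]. *)
Fixpoint bary n k b : R :=
  if n is m.+1 then
    if k == n then b n else bary m k b - a m k * b n
  else b 0%N.

Lemma bary_diag n b : bary n n b = b n.
Proof. by case: n => //= n; rewrite eqxx. Qed.

Lemma bary_step n k b : (k <= n)%N ->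
  bary n k b = bary n.+1 k b + a n k * bary n.+1 n.+1 b.
Proof. by move=> kn; rewrite /= eqxx ltn_eqF ?ltnS// subrK. Qed.

Lemma bary_ext n k b b' : (forall m, (m <= n)%N -> b m = b' m) ->
  bary n k b = bary n k b'.
Proof.
elim: n k => [|n IHn] k bb' /=; first exact: bb'.
by rewrite bb'// IHn// => m mn; rewrite bb'// leqW.
Qed.

Lemma baryP n k (t : R) b b' :
  bary n k (t *: b + b') = t * bary n k b + bary n k b'.
Proof.
elim: n k => [//|n IHn] k /=.
rewrite -[(_ *: _ + _) n.+1]/(t * b n.+1 + b' n.+1).
by case: ifP => // _; rewrite IHn; ring.
Qed.

Lemma bary0 n k : bary n k 0 = 0.
Proof. by have := baryP n k (-1) 0 0; rewrite scaler0 addr0 mulN1r addNr. Qed.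

Lemma baryD n k b b' : bary n k (b + b') = bary n k b + bary n k b'.
Proof. by have := baryP n k 1 b b'; rewrite scale1r mul1r. Qed.

Lemma baryZ n k (t : R) b : bary n k (t *: b) = t * bary n k b.
Proof. by have := baryP n k t b 0; rewrite !addr0 bary0 addr0. Qed.

Lemma baryN n k b : bary n k (- b) = - bary n k b.
Proof. by rewrite -scaleN1r baryZ mulN1r. Qed.

Lemma baryB n k b b' : bary n k (b - b') = bary n k b - bary n k b'.
Proof. by rewrite baryD baryN. Qed.

Lemma bary_sum_comb n k (I : Type) (r : seq I) (P : pred I)
    (F : I -> real_seq R) :
  bary n k (\sum_(i <- r | P i) F i) = \sum_(i <- r | P i) bary n k (F i).
Proof. by apply: (big_morph (bary n k)) => [b b'|];
  [exact: baryD|exact: bary0]. Qed.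

(** As the weights [a n] sum to 1, passing to the next level preserves the total mass. *)
Lemma bary_total n b : \sum_(k < n.+1) bary n k b = b 0%N.
Proof.
elim: n => [|n IHn]; first by rewrite big_ord1.
rewrite big_ord_recr bary_diag -IHn.
rewrite [RHS](eq_bigr (fun k : 'I_n.+1 => bary n.+1 k b + a n k * b n.+1)).
  by rewrite big_split/= -mulr_suml a_sum mul1r.
by move=> k _; rewrite bary_step -1?ltnS// bary_diag.
Qed.

Lemma bary_continuous n k : continuous (fun b => bary n k b : R^o).
Proof.
elim: n k => [|n IHn] k /=; first exact: real_seq_eval_continuous.
case: (k == n.+1); first exact: real_seq_eval_continuous.
move=> b; apply: (@cvgB R R^o (real_seq R) (nbhs b) _ (bary n k)
  (fun b => a n k * b n.+1)).
  exact: IHn.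
apply: (@cvgZ R R^o (real_seq R) (nbhs b) _ (fun=> a n k));
  first exact: cvg_cst.
exact: real_seq_eval_continuous.
Qed.

Arguments bary : simpl never.

Definition bary_cone : set (real_seq R) :=
  [set b | forall n k, (k <= n)%N -> 0 <= bary n k b].

Lemma bary_coneD b b' : bary_cone b -> bary_cone b' -> bary_cone (b + b').
Proof. by move=> Kb Kb' n k kn; rewrite baryD addr_ge0 ?Kb ?Kb'. Qed.

Lemma bary_coneZ (t : R) b : 0 <= t -> bary_cone b -> bary_cone (t *: b).
Proof. by move=> t0 Kb n k kn; rewrite baryZ mulr_ge0 ?Kb. Qed.

Lemma bary_cone0 : bary_cone 0.
Proof. by move=> n k _; rewrite bary0. Qed.

Lemma bary_cone_ge0 b n : bary_cone b -> 0 <= b n.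
Proof. by move=> /(_ n n (leqnn n)); rewrite bary_diag. Qed.

Lemma bary_cone_le b n k : bary_cone b -> (k <= n)%N -> bary n k b <= b 0%N.
Proof.
move=> Kb kn; rewrite -(bary_total n) (bigD1 (Ordinal (kn : (k < n.+1)%N)))//=.
by rewrite lerDl sumr_ge0// => i _; rewrite Kb// -ltnS.
Qed.

Lemma bary_cone_eq0 b : bary_cone b -> b 0%N = 0 -> b = 0.
Proof.
move=> Kb b0; apply/funext => n; apply/le_anti.
have := bary_cone_le Kb (leqnn n); rewrite bary_diag b0 => bn.
by apply/andP; split; [exact: bn|exact: bary_cone_ge0].
Qed.

Definition bary_base : set (real_seq R) := [set b | bary_cone b /\ b 0%N = 1].

(** A closed subset of a cube that is compact by Tychonoff's theorem. *)
Lemma bary_base_compact : compact bary_base.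
Proof.
apply: (@subclosed_compact _ _ [set f : {ptws nat -> R^o} | forall i,
  `[0, 1]%classic (f i)]).
- rewrite (_ : bary_base = (\bigcap_n \bigcap_(k in [set k | (k <= n)%N])
      (fun b => bary n k b) @^-1` [set x : R | 0 <= x]) `&`
      (fun b : real_seq R => b 0%N) @^-1` [set 1]).
    apply: closedI; last first.
      by apply: closed_comp; [move=> b _;
        exact: real_seq_eval_continuous|exact: closed_eq].
    apply: closed_bigI => n _; apply: closed_bigI => k _.
    by apply: closed_comp; [move=> b _;
      exact: bary_continuous|exact: closed_ge].
  apply/seteqP; split=> [b [Kb b0]|b [Kb b0]]; split=> //.
    by move=> n _ k; exact: Kb.
  by move=> n k kn; exact: Kb.
- by apply: (@tychonoff nat (fun=> R^o) (fun=> `[0, 1]%classic)) => _;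
    exact: segment_compact.
- move=> b [Kb b0] n /=; rewrite in_itv/= bary_cone_ge0//=.
  by rewrite -(bary_diag n) -b0 bary_cone_le.
Qed.

Lemma bary_base_convex : convex_set bary_base.
Proof.
apply: convex_setI01 => b b' t [Kb b0] [Kb' b'0] /andP[t0 t1]; split.
  by apply: bary_coneD; apply: bary_coneZ => //; rewrite subr_ge0.
by rewrite -[LHS]/(t * b 0%N + (1 - t) * b' 0%N) b0 b'0; ring.
Qed.

Lemma bary_base_neq0 : bary_base !=set0.
Proof.
(* The chosen point has all its mass at vertex 0 on every level. *)
have bE n k : bary n.+1 k (fun m => (m == 0)%:R) =
  bary n k (fun m => (m == 0)%:R) *+ (k != n.+1).
  by rewrite /bary -/bary; case: eqP => //=; rewrite mulr0 subr0.
exists (fun m => (m == 0)%:R); split=> //.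
elim=> [|n IHn] k kn //; rewrite bE; have [->//|kn1] := eqVneq k n.+1.
by rewrite mulr1n IHn// -ltnS ltn_neqAle kn1.
Qed.

Section bary_sup.
Variables u v h : real_seq R.
Hypotheses (uh : bary_cone (h - u)) (vh : bary_cone (h - v)).

(* The maximum of the coordinates of level [n + d], pushed down to level [n]: it
   increases with [d], and the limits are the coordinates of the supremum. *)
Fixpoint bary_push d n k : R :=
  if d is e.+1 then bary_push e n.+1 k + a n k * bary_push e n.+1 n.+1
  else Num.max (bary n k u) (bary n k v).

(** For [d = 0], a maximum of sums is at most the sum of the maxima; pushing down with nonnegative
    weights preserves the inequality. *)
Lemma bary_push_homo d n k : (k <= n)%N ->
  bary_push d n k <= bary_push d.+1 n k.
Proof.
elim: d n k => [|d IHd] n k kn; last first.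
  rewrite [leLHS]/= [leRHS]/= lerD ?IHd ?leqW//.
  by rewrite ler_wpM2l ?a_ge0// IHd.
have le1 w : (forall m l, bary m l w <= bary_push 0 m l) ->
    bary n k w <= bary_push 1 n k.
  move=> wp; rewrite (bary_step w kn); apply: lerD; first exact: wp.
  by rewrite ler_wpM2l ?a_ge0// wp.
by rewrite ge_max !le1// => m l; rewrite /= le_max lexx ?orbT.
Qed.

Lemma bary_push_le w d n k : bary_cone (w - u) -> bary_cone (w - v) ->
  (k <= n)%N -> bary_push d n k <= bary n k w.
Proof.
move=> uw vw; elim: d n k => [|d IHd] n k kn.
  rewrite ge_max -subr_ge0 -baryB uw//=.
  by rewrite -subr_ge0 -baryB vw.
by rewrite (bary_step w kn) /= lerD ?ler_wpM2l ?a_ge0 ?IHd// leqW.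
Qed.

Let lim_push n k := limn (fun d => bary_push d n k).

Let push_cvg n k : (k <= n)%N -> bary_push d n k @[d --> \oo] --> lim_push n k.
Proof.
move=> kn; apply: nondecreasing_is_cvgn.
  by apply/nondecreasing_seqP => d; exact: bary_push_homo.
by exists (bary n k h) => _ [d _ <-]; exact: bary_push_le.
Qed.

Let lim_push_step n k : (k <= n)%N ->
  lim_push n k = lim_push n.+1 k + a n k * lim_push n.+1 n.+1.
Proof.
move=> kn; apply: (@cvg_unique _ (@Rhausdorff R)
  (bary_push d.+1 n k @[d --> \oo])).
  by have := push_cvg kn; rewrite -cvg_shiftS; exact.
rewrite /=; apply: cvgD; first by apply: push_cvg; rewrite leqW.
by apply: cvgM; [exact: cvg_cst|exact: push_cvg].
Qed.

(** By [lim_push_step] the limits are compatible between levels, so they are the coordinates of a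
    point of the inverse limit, coded by its diagonal. *)
Lemma bary_sup_exists : exists w, [/\ bary_cone (w - u), bary_cone (w - v) &
  forall w', bary_cone (w' - u) -> bary_cone (w' - v) -> bary_cone (w' - w)].
Proof.
pose w : real_seq R := fun n => lim_push n n.
have wE n k : (k <= n)%N -> bary n k w = lim_push n k.
  elim: n k => [|n IHn] k; first by rewrite leqn0 => /eqP->.
  rewrite leq_eqVlt ltnS => /predU1P[->|kn]; first exact: bary_diag.
  have := bary_step w kn; rewrite IHn// lim_push_step// bary_diag.
  by move/addIr.
have le_w n k : (k <= n)%N -> bary_push 0 n k <= bary n k w.
  move=> kn; rewrite wE//; apply: (nondecreasing_cvgn_le _ (push_cvg kn)).
  by apply/nondecreasing_seqP => d; exact: bary_push_homo.
exists w; split.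
- move=> n k kn; rewrite baryB subr_ge0; apply: le_trans (le_w n k kn).
  by rewrite /= le_max lexx.
- move=> n k kn; rewrite baryB subr_ge0; apply: le_trans (le_w n k kn).
  by rewrite /= le_max lexx orbT.
move=> w' uw' vw' n k kn; rewrite baryB subr_ge0 wE//.
rewrite -(cvg_lim (@Rhausdorff R) (push_cvg kn)); apply: limr_le.
  exact: push_cvg.
by apply: nearW => d; exact: bary_push_le.
Qed.

End bary_sup.

(** The base lies in the hyperplane of total mass 1, so the second component of a point of the cone
    is the mass of the first. At mass 0 the first component vanishes and any base point serves. *)
Lemma base_cone_bary (p : real_seq R * R^o) :
  base_cone bary_base p <-> bary_cone p.1 /\ p.1 0%N = p.2.
Proof.
split=> [[p20 [b [Kb b0] ->]]|[Kp p0]].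
  split; first exact: bary_coneZ.
  by rewrite -[LHS]/(p.2 * b 0%N) b0 mulr1.
have p2 : 0 <= p.2 by rewrite -p0 bary_cone_ge0.
split=> //; have [p20|p2n0] := eqVneq p.2 0.
  have [b Sb] := bary_base_neq0; exists b => //.
  by rewrite p20 scale0r (bary_cone_eq0 Kp)// p0.
exists (p.2^-1 *: p.1); last by rewrite scalerA divff// scale1r.
split; first by apply: bary_coneZ; rewrite ?invr_ge0.
by rewrite -[LHS]/(p.2^-1 * p.1 0%N) p0 mulVf.
Qed.

Lemma bary_base_simplex : simplex bary_base.
Proof.
pose E b : real_seq R * R^o := (b, b 0%N).
have spanE p : cone_span bary_base p ->
    exists b q, [/\ p = E b, bary_cone q & bary_cone (q - b)].
  move=> [x [y [/base_cone_bary[Kx x0] /base_cone_bary[Ky y0] ->]]].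
  exists (x.1 - y.1), x.1; split=> //; last by rewrite subKr.
  by case: x y {Kx Ky} x0 y0 => [x _] [y _] /= <- <-.
have Espan b q : bary_cone q -> bary_cone (q - b) -> cone_span bary_base (E b).
  move=> Kq Kqb; exists (E q), (E (q - b)); split; [exact/base_cone_bary..|].
  by rewrite /E; congr (_, _); rewrite /= subKr.
have leE b b' : cone_le bary_base (E b) (E b') <-> bary_cone (b' - b).
  by split=> [/base_cone_bary[]//|Kb]; apply/base_cone_bary.
have sup b b' q q' : bary_cone q -> bary_cone (q - b) -> bary_cone q' ->
    bary_cone (q' - b') -> exists w, [/\ bary_cone (w - b), bary_cone (w - b'),
    exists2 h, bary_cone h & bary_cone (h - w) &
    forall w', bary_cone (w' - b) -> bary_cone (w' - b') -> bary_cone (w' - w)].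
  move=> Kq Kqb Kq' Kqb'.
  have h1 : bary_cone (q + q' - b) by rewrite addrAC; exact: bary_coneD.
  have h2 : bary_cone (q + q' - b') by rewrite -addrA; exact: bary_coneD.
  have [w [bw b'w wmin]] := bary_sup_exists h1 h2.
  by exists w; split=> //; exists (q + q'); [exact: bary_coneD|exact: wmin].
move=> p p' /spanE[b [q [-> Kq Kqb]]] /spanE[b' [q' [-> Kq' Kqb']]]; split.
  have [w [bw b'w [h Kh Khw] wmin]] := sup _ _ _ _ Kq Kqb Kq' Kqb'.
  exists (E w); split; [exact: Espan Khw|exact/leE|exact/leE|].
  by move=> p0 /spanE[w' [_ [-> _ _]]] /leE ? /leE ?; exact/leE/wmin.
(* Infima are opposites of suprema of opposites; [q - b] plays for [- b] the role of [q] for [b]. *)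
have KqN x y : bary_cone y -> bary_cone (y - x) -> bary_cone (y - x - - x).
  by move=> Ky _; rewrite opprK subrK.
have [w [bw b'w [h Kh Khw] wmin]] := sup (- b) (- b') _ _ Kqb
  (KqN _ _ Kq Kqb) Kqb' (KqN _ _ Kq' Kqb').
have KN (x y : real_seq R) : bary_cone (x - - y) -> bary_cone (y - - x).
  by rewrite !opprK addrC.
exists (E (- w)); split.
- by apply: (Espan _ (h - w)) => //; rewrite opprK subrK.
- exact/leE/KN.
- exact/leE/KN.
move=> p0 /spanE[w' [_ [-> _ _]]] /leE bw' /leE b'w'; apply/leE.
by rewrite addrC; apply: wmin; rewrite opprK addrC.
Qed.

Lemma real_seq_hausdorff : hausdorff_space (real_seq R : tvsType R).
Proof. by apply: (@hausdorff_product nat (fun=> R^o)) => _;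
  exact: Rhausdorff. Qed.

Definition bary_simplex : choquet_simplex R :=
  @ChoquetSimplex R (real_seq R) bary_base real_seq_hausdorff bary_base_neq0
    bary_base_compact
    bary_base_convex bary_base_simplex.

(** The sequence with coordinates [y] at level [n] and zeros beyond; [y] is pushed down with the
    weights to find the lower levels. *)
Fixpoint bary_lift n (y : nat -> R) : real_seq R :=
  if n is m.+1 then fun k =>
    if k == n then y n else bary_lift m (fun i => y i + a m i * y n) k
  else fun k => if k == 0%N then y 0%N else 0.

Lemma bary_lift_gt n y k : (n < k)%N -> bary_lift n y k = 0.
Proof.
elim: n y => [|n IHn] y nk /=; first by case: k nk.
by rewrite gtn_eqF// IHn// ltnW.
Qed.

Lemma bary_liftE n y k : (k <= n)%N -> bary n k (bary_lift n y) = y k.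
Proof.
elim: n y k => [|n IHn] y k; first by rewrite leqn0 => /eqP->.
rewrite leq_eqVlt ltnS => /predU1P[->|kn]; first by rewrite bary_diag /= eqxx.
have yn : bary_lift n.+1 y n.+1 = y n.+1 by rewrite /= eqxx.
have := bary_step (bary_lift n.+1 y) kn; rewrite bary_diag yn.
rewrite (@bary_ext n k _ (bary_lift n (fun i => y i + a n i * y n.+1))).
  by rewrite IHn// => /addIr.
by move=> m mn /=; rewrite ltn_eqF.
Qed.

Lemma bary_ge0_down n b : (forall k, (k <= n)%N -> 0 <= bary n k b) ->
  forall m k, (m <= n)%N -> (k <= m)%N -> 0 <= bary m k b.
Proof.
move=> b0 m k mn; rewrite -(subnKC mn) in b0;
  elim: (n - m)%N b0 k => {mn}[|d IHd].
  by rewrite addn0.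
rewrite addnS => b0; apply: IHd => k kn.
by rewrite bary_step// addr_ge0 ?mulr_ge0 ?a_ge0 ?b0// leqW.
Qed.

(** Downward positivity applies to both differences, whose coordinates at level [n] are 0. *)
Lemma bary_eq n b b' : (forall k, (k <= n)%N -> bary n k b = bary n k b') ->
  forall m, (m <= n)%N -> b m = b' m.
Proof.
move=> bb' m mn; apply/le_anti/andP; split.
  rewrite -subr_ge0 -!bary_diag -baryB; apply: (bary_ge0_down _ mn) => // k kn.
  by rewrite baryB bb' ?subrr.
rewrite -subr_ge0 -!bary_diag -baryB; apply: (bary_ge0_down _ mn) => // k kn.
by rewrite baryB bb' ?subrr.
Qed.

Lemma bary_level_eq n b b' : (forall m, (n < m)%N -> b m = b' m) ->
  (forall k, (k <= n)%N -> bary n k b = bary n k b') -> b = b'.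
Proof.
move=> out inn; apply/funext => m; have [nm|mn] := ltnP n m; first exact: out.
exact: bary_eq inn _ mn.
Qed.

Lemma bary_cone_truncated n b : (forall k, (k <= n)%N -> 0 <= bary n k b) ->
  (forall m, (n < m)%N -> b m = 0) -> bary_cone b.
Proof.
move=> b0 bn m k km; have [mn|/ltnW nm] := leqP m n.
  exact: (bary_ge0_down b0 mn km).
rewrite -(subnKC nm) in km *; elim: (m - n)%N k km => {nm}[|d IHd] k.
  by rewrite addn0; exact: b0.
rewrite addnS leq_eqVlt ltnS => /predU1P[->|kd].
  by rewrite bary_diag bn// ltnS leq_addr.
have := bary_step b kd; rewrite bary_diag bn ?mulr0 ?addr0;
  last by rewrite ltnS leq_addr.
by move=> <-; exact: IHd.
Qed.

(** The vertex that appears at level [k]; it remains a vertex at all later levels. *)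
Definition bary_vertex k : real_seq R := bary_lift k (fun i => (i == k)%:R).

Lemma bary_vertex_gt k m : (k < m)%N -> bary_vertex k m = 0.
Proof. exact: bary_lift_gt. Qed.

Lemma bary_vertexE n k l : (k <= n)%N -> (l <= n)%N ->
  bary n l (bary_vertex k) = (l == k)%:R.
Proof.
move=> kn; rewrite -(subnKC kn); elim: (n - k)%N l => {n kn}[|d IHd] l.
  by rewrite addn0 => lk; rewrite bary_liftE.
rewrite addnS leq_eqVlt ltnS => /predU1P[->|ld].
  by rewrite bary_diag bary_vertex_gt ?ltnS ?leq_addr// gtn_eqF// ltnS leq_addr.
have := bary_step (bary_vertex k) ld;
  rewrite bary_diag bary_vertex_gt ?ltnS ?leq_addr//.
by rewrite mulr0 addr0 => <-; exact: IHd.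
Qed.

Lemma bary_vertex_base k : bary_base (bary_vertex k).
Proof.
split.
  apply: (@bary_cone_truncated k); last exact: bary_vertex_gt.
  by move=> l lk; rewrite bary_vertexE.
rewrite -(bary_total k) (bigD1 ord_max)//= bary_vertexE// eqxx big1 ?addr0// =>
  i ik.
rewrite bary_vertexE -1?ltnS//; case: eqP => // ik'.
by move: ik; rewrite -val_eqE/= ik' eqxx.
Qed.

Definition bary_trunc n b : real_seq R := fun m =>
  if (m <= n)%N then b m else 0.

(** Both sides vanish beyond [n] and have the same coordinates at level [n], which determines
    them. *)
Lemma bary_truncE n b : bary_trunc n b =
  \sum_(k < n.+1) bary n k b *: bary_vertex k.
Proof.
apply: (@bary_level_eq n) => [m nm|k kn].
  rewrite /bary_trunc leqNgt nm/=.
  have E (I : Type) (r : seq I) (F : I -> real_seq R) :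
      (\sum_(i <- r) F i) m = \sum_(i <- r) F i m.
    exact: (big_morph (fun b : real_seq R => b m : R^o)).
  rewrite E big1// => i _.
  rewrite -[LHS]/(bary n i b * bary_vertex i m) bary_vertex_gt ?mulr0//.
  by rewrite (leq_ltn_trans _ nm)// -ltnS.
rewrite (@bary_ext n k _ b); last by move=> m mn; rewrite /bary_trunc mn.
rewrite bary_sum_comb (bigD1 (Ordinal (kn : (k < n.+1)%N)))//= baryZ.
rewrite bary_vertexE// eqxx mulr1 big1 ?addr0// => i ik.
rewrite baryZ bary_vertexE -1?ltnS//; case: eqP => [ki|_];
  last by rewrite mulr0.
by move: ik; rewrite -val_eqE/= ki eqxx.
Qed.

Lemma bary_base_comb n (w : nat -> R) (p : nat -> real_seq R) :
  (forall k, (k <= n)%N -> 0 <= w k) -> \sum_(k < n.+1) w k = 1 ->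
  (forall k, bary_base (p k)) -> bary_base (\sum_(k < n.+1) w k *: p k).
Proof.
move=> w0 w1 pS; split.
  apply: (big_ind bary_cone) => [||i _]; [exact: bary_cone0|exact: bary_coneD|].
  by apply: bary_coneZ; [rewrite w0// -ltnS|exact: (pS i).1].
have E (I : Type) (r : seq I) (F : I -> real_seq R) :
    (\sum_(i <- r) F i) 0%N = \sum_(i <- r) F i 0%N.
  exact: (big_morph (fun b : real_seq R => b 0%N : R^o)).
rewrite E -[RHS]w1; apply: eq_bigr => i _.
by rewrite -[LHS]/(w i * p i 0%N) (pS i).2 mulr1.
Qed.

Lemma bary_trunc_base n b : bary_base b -> bary_base (bary_trunc n b).
Proof.
move=> [Kb b0]; rewrite bary_truncE.
apply: (@bary_base_comb n (fun k => bary n k b)).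
- by move=> k; exact: Kb.
- by rewrite bary_total.
- exact: bary_vertex_base.
Qed.

(** * Affine functions on the inverse limit *)

Implicit Types f : affine_space bary_simplex.

Definition bary_point b (Sb : bary_base b) : bary_simplex :=
  exist _ b (mem_set Sb).

Lemma bary_point_val b (Sb : bary_base b) : set_val (bary_point Sb) = b.
Proof. by []. Qed.

Definition vertex k : bary_simplex := bary_point (bary_vertex_base k).

Definition truncate n (x : bary_simplex) : bary_simplex :=
  bary_point (bary_trunc_base n (set_valP x)).

(** Induction on [n]: the last point is split off and the other weights are divided by their sum
    [t], unless [t] is 0 and the last point is [z] itself. *)
Lemma affine_combination f n (w : nat -> R) (p : nat -> bary_simplex)
    (z : bary_simplex) : (forall k, (k <= n)%N -> 0 <= w k) ->
  \sum_(k < n.+1) w k = 1 ->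
  set_val z = \sum_(k < n.+1) w k *: set_val (p k) ->
  f z = \sum_(k < n.+1) w k * f (p k).
Proof.
have [aff _] : affine_on f /\ continuous f by have := affine_valP f;
  rewrite inE.
elim: n w z => [|n IHn] w z w0 w1 zE.
  move: w1 zE; rewrite !big_ord1 => -> zE; rewrite mul1r; congr (f _).
  by apply: val_inj; move: zE; rewrite scale1r.
move: w1 zE; rewrite big_ord_recr/=; set t := \sum_(_ < _) _ => w1 zE.
have t0 : 0 <= t by apply: sumr_ge0 => k _; rewrite w0// ltnW.
have tE : w n.+1 = 1 - t by rewrite -w1 [t + _]addrC addrK.
have t1 : t <= 1 by rewrite -subr_ge0 -tE w0.
rewrite big_ord_recr/= in zE; rewrite big_ord_recr/=.
have [tz|tn0] := eqVneq t 0.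
  have wz (k : 'I_n.+1) : w k = 0.
    by apply: (psumr_eq0P _ tz) => // i _; rewrite w0// ltnW.
  rewrite big1 => [|k _]; last by rewrite wz mul0r.
  rewrite add0r tE tz subr0 mul1r; congr (f _); apply: val_inj.
  move: zE; rewrite big1 => [|k _]; last by rewrite wz scale0r.
  by rewrite add0r tE tz subr0 scale1r.
have w'1 : \sum_(k < n.+1) w k / t = 1 by rewrite -mulr_suml divff.
have w'0 k : (k <= n)%N -> 0 <= w k / t.
  by move=> kn; rewrite divr_ge0// w0// leqW.
have z'S := @bary_base_comb n (fun k => w k / t) (fun k => set_val (p k)) w'0
  w'1
  (fun k => set_valP (p k)).
rewrite (aff (bary_point z'S) (p n.+1) z t) ?t0//; last first.
  rewrite bary_point_val zE tE; congr (_ + _); rewrite scaler_sumr.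
  by apply: eq_bigr => k _; rewrite scalerA mulrC divfK.
rewrite tE; congr (_ + _); rewrite (IHn (fun k => w k / t))// mulr_sumr.
by apply: eq_bigr => k _; rewrite mulrA [t * _]mulrC divfK.
Qed.

Lemma affine_truncate f n x : f (truncate n x) =
  \sum_(k < n.+1) bary n k (set_val x) * f (vertex k).
Proof.
have [Kx x0] := set_valP x.
apply: (@affine_combination f n (fun k => bary n k (set_val x))).
- by move=> k; exact: Kx.
- by rewrite bary_total.
- by rewrite bary_point_val bary_truncE.
Qed.

(** Near each point [f] varies little on a cylinder, and truncation beyond the length of the
    cylinder does not leave it; compactness makes this uniform. *)
Lemma affine_truncate_cvg f (e : R) : 0 < e ->
  \forall n \near \oo, forall x, `|f x - f (truncate n x)| <= e.
Proof.
move=> e0.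
have /compact_near_coveringP cov := bary_base_compact.
have := cov nat \oo (fun n b => forall x : bary_simplex, set_val x = b ->
  `|f x - f (truncate n x)| <= e) _ _.
have H : forall b, bary_base b -> \forall b' \near b & n \near \oo,
    forall x : bary_simplex, set_val x = b' -> `|f x - f (truncate n x)| <= e.
  move=> b Sb; have /cvgrPdist_le := @affine_continuous _ _ f (bary_point Sb).
  move=> /(_ (e / 2)); rewrite divr_gt0// => /(_ isT) fb.
  have [U [oU Ub] UE] : exists2 U : set (real_seq R), open U /\ U b &
      forall x : bary_simplex, U (set_val x) ->
        `|f (bary_point Sb) - f x| <= e / 2.
    move: fb; rewrite nearE /= => -[_ [[U oU <-] Ub UE]].
    by exists U => // x Ux; exact: UE.
  have /nbhs_cylinder[n [d [d0 bU]]] : nbhs b U by exact: open_nbhs_nbhs.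
  exists (cylinder b n d, [set m | (n <= m)%N]).
    split=> /=; last by exists n.
    apply: open_nbhs_nbhs; split; first exact: cylinder_open.
    by move=> k _; rewrite subrr normr0.
  move=> [b' m] /= [bb' nm] x xb'.
  have h1 : `|f (bary_point Sb) - f x| <= e / 2 by apply: UE; rewrite xb';
    exact: bU.
  have h2 : `|f (bary_point Sb) - f (truncate m x)| <= e / 2.
    have tE k : set_val (truncate m x) k = bary_trunc m b' k by rewrite -xb'.
    apply: UE; apply: bU => k kn; rewrite tE /bary_trunc.
    by rewrite (ltnW (leq_trans kn nm)); exact: bb'.
  rewrite (le_trans (ler_distD (f (bary_point Sb)) _ _))//.
  by rewrite (distrC (f x)); lra.
move=> /(_ _ H) {}cov; apply: filterS cov => n hn x.
by apply: (hn (set_val x)) => //; exact: set_valP.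
Qed.

Lemma bary_affine_subproof n k :
  (fun x : bary_simplex => bary n k (set_val x) : R^o) \in
  affine_pred (S := bary_simplex).
Proof.
rewrite inE; split=> [x y z t _ zE|x].
  by rewrite zE baryP baryZ.
apply: (@continuous_comp bary_simplex (real_seq R) R^o set_val (bary n k)).
  exact: initial_continuous.
exact: bary_continuous.
Qed.

Definition bary_affine n k : affine_space bary_simplex :=
  Affine (bary_affine_subproof n k).

(** The coordinates of level [n], evaluated at the first [n + 1] vertices, give the identity matrix;
    a spanning family of size [n] would factor it through rank [n]. *)
Lemma bary_simplex_infinite_dimensional :
  ~ finite_dimensional (affine_space bary_simplex).
Proof.
move=> [n [e eP]].
have /choice[C CE] (i : 'I_n.+1) : exists c : 'I_n -> R,
    bary_affine n i = \sum_(j < n) c j *: e j by exact: eP.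
have M1 : (\matrix_(i, j) C i j) *m (\matrix_(j < n, k < n.+1) e j (vertex k)) =
    1%:M :> 'M[R]_n.+1.
  apply/matrixP => i k; rewrite !mxE.
  have : bary_affine n i (vertex k) = (i == k)%:R.
    by rewrite -[LHS]/(bary n i (bary_vertex k)) bary_vertexE -1?ltnS.
  rewrite CE => <-.
  have E (I : Type) (r : seq I) (F : I -> affine_space bary_simplex) x :
      (\sum_(i <- r) F i) x = \sum_(i <- r) F i x.
    exact: (big_morph (fun f : affine_space bary_simplex => f x : R^o)).
  by rewrite E; apply: eq_bigr => j _; rewrite !mxE.
have := mxrankM_maxl (\matrix_(i, j) C i j)
  (\matrix_(j < n, k < n.+1) e j (vertex k)).
rewrite M1 mxrank1 => /leq_trans/(_ (rank_leq_col _)).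
by rewrite ltnn.
Qed.

(** * The isometric embedding of the affine functions into [X] *)

Section tower_embedding.
Context {X : completeNormedModType R}.
Variable u : nat -> nat -> X.
Hypothesis u_step : forall n k, (k <= n)%N ->
  u n k = u n.+1 k + a n k *: u n.+1 n.+1.
Hypothesis u_le : forall n (y : nat -> R) (M : R), 0 <= M ->
  (forall k, (k <= n)%N -> `|y k| <= M) -> `|\sum_(k < n.+1) y k *: u n k| <= M.
Hypothesis u_ge : forall n (y : nat -> R) l, (l <= n)%N ->
  `|y l| <= `|\sum_(k < n.+1) y k *: u n k|.

(** At the levels up to [n], the new vertex sits at the point of the old simplex with weights [a n]:
    its truncation at [n] has these coordinates. *)
Lemma bary_vertex_next m n k : (m <= n)%N -> (k <= m)%N ->
  bary m k (bary_vertex n.+1) =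
  \sum_(l < n.+1) a n l * bary m k (bary_vertex l).
Proof.
move=> mn km; rewrite (@bary_ext m k _ (bary_trunc n (bary_vertex n.+1))).
  rewrite bary_truncE bary_sum_comb; apply: eq_bigr => l _; rewrite baryZ.
  have ln : (l <= n)%N by rewrite -ltnS.
  congr (_ * _); rewrite (bary_step _ ln) !bary_vertexE// ?leqW//.
  by rewrite eqxx mulr1 ltn_eqF ?ltnS// add0r.
by move=> i im; rewrite /bary_trunc (leq_trans im mn).
Qed.

(** Iteration of [u_step]. The vector [u n k] corresponds to the affine function [bary n k], and its
    coefficients are the values of that function at the vertices. *)
Lemma tower_expand n m k : (k <= n)%N -> (n <= m)%N ->
  u n k = \sum_(l < m.+1) bary n k (bary_vertex l) *: u m l.
Proof.
move=> kn nm; rewrite -(subnKC nm); elim: (m - n)%N => {m nm}[|d IHd].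
  rewrite addn0 (bigD1 (Ordinal (kn : (k < n.+1)%N)))//=
    bary_vertexE// eqxx scale1r.
  rewrite big1 ?addr0// => l lk; rewrite bary_vertexE -1?ltnS//.
  case: eqP => [kl|_]; last by rewrite scale0r.
  by move: lk; rewrite -val_eqE/= kl eqxx.
rewrite IHd addnS [RHS]big_ord_recr/=; set m := (n + d)%N.
rewrite [LHS](eq_bigr (fun l : 'I_m.+1 => bary n k (bary_vertex l) *: u m.+1 l +
    (a m l * bary n k (bary_vertex l)) *: u m.+1 m.+1)).
  rewrite big_split/= -scaler_suml; congr (_ + _ *: _).
  by rewrite (bary_vertex_next _ kn)// leq_addr.
move=> l _; rewrite u_step -1?ltnS// scalerDr scalerA; congr (_ + _ *: _).
by rewrite mulrC.
Qed.

(** By [affine_truncate], the vector that corresponds to the function [f (truncate n x)] of [x]. *)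
Definition tower_approx f n : X := \sum_(k < n.+1) f (vertex k) *: u n k.

Lemma tower_approx_dist f n m : (n <= m)%N ->
  tower_approx f m - tower_approx f n =
  \sum_(l < m.+1) (f (vertex l) - f (truncate n (vertex l))) *: u m l.
Proof.
move=> nm; rewrite /tower_approx.
rewrite [X in _ - X](eq_bigr (fun k : 'I_n.+1 => \sum_(l < m.+1)
    (bary n k (bary_vertex l) * f (vertex k)) *: u m l)); last first.
  move=> k _; rewrite (@tower_expand n m k) -1?ltnS// scaler_sumr.
  by apply: eq_bigr => l _; rewrite scalerA mulrC.
rewrite exchange_big/= -sumrB; apply: eq_bigr => l _.
by rewrite -scaler_suml scalerBl affine_truncate.
Qed.

Lemma tower_approx_cvg f : cvgn (tower_approx f).
Proof.
apply/cauchy_cvgP/cauchy_ballP => e e0.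
have [N _ fN] : \forall n \near \oo,
    forall x, `|f x - f (truncate n x)| <= e / 4.
  by apply: affine_truncate_cvg; rewrite divr_gt0.
have near_N m : (N <= m)%N -> `|tower_approx f m - tower_approx f N| <= e / 4.
  move=> Nm; rewrite tower_approx_dist//.
  apply: (@u_le m (fun l => f (vertex l) - f (truncate N (vertex l))));
    first by rewrite ltW// divr_gt0.
  by move=> k _; apply: fN => /=.
pose A := tower_approx f @` [set m | (N <= m)%N].
exists (A, A) => /=; first by split; exists N => // m Nm; exists m.
move=> [_ _] [[m /near_N Nm <-] [m' /near_N Nm' <-]]; rewrite -ball_normE /=.
have := ler_distD (tower_approx f N) (tower_approx f m) (tower_approx f m').
rewrite (distrC (tower_approx f N)); lra.
Qed.

Definition tower_map f : X := limn (tower_approx f).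

Lemma tower_map_linear : linear tower_map.
Proof.
move=> t f g; apply: cvg_lim => //.
rewrite (_ : tower_approx _ = fun n =>
  t *: tower_approx f n + tower_approx g n).
  by apply: cvgD; [apply: cvgZr|]; exact: tower_approx_cvg.
apply/funext => n; rewrite /tower_approx scaler_sumr -big_split/=.
by apply: eq_bigr => k _; rewrite scalerA -scalerDl.
Qed.

(** The upper bound passes to the limit from [u_le]. For the lower one, [f (truncate n x)] is a
    convex combination of values at vertices, each bounded by the norm of the approximation through
    [u_ge]. *)
Lemma tower_map_isometry f : `|tower_map f| = `|f|.
Proof.
have cf : (fun n => `|tower_approx f n|) @ \oo --> `|tower_map f|.
  by apply: cvg_norm; exact: tower_approx_cvg.
apply/le_anti/andP; split.
  rewrite -(cvg_lim (@Rhausdorff R) cf); apply: limr_le; first by apply/cvg_ex;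
    eexists; exact: cf.
  apply: nearW => n; apply: (@u_le n (fun k => f (vertex k))) => // k _.
  exact: affine_apply_le.
apply: affine_norm_le => x; apply/ler_addgt0Pr => e e0.
have e2 : 0 < e / 2 by rewrite divr_gt0.
move/cvgrPdist_le : cf => /(_ _ e2) cf.
have fx := affine_truncate_cvg f e2.
near \oo => n.
have h1 : `|f x - f (truncate n x)| <= e / 2 by near: n; apply: filterS fx => n;
  exact.
have h2 : `| `|tower_map f| - (`|tower_approx f n|)| <= e / 2 by near: n.
have h3 : `|f (truncate n x)| <= `|tower_approx f n|.
  have [Kx x0] : bary_base (set_val x) := set_valP x.
  rewrite affine_truncate; apply: le_trans (ler_norm_sum _ _ _) _.
  apply: (@le_trans _ _
    (\sum_(k < n.+1) bary n k (set_val x) * `|tower_approx f n|)).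
    apply: ler_sum => k _; rewrite normrM ger0_norm ?Kx -1?ltnS//.
    by rewrite ler_wpM2l ?Kx -1?ltnS// (u_ge (fun k => f (vertex k))) -1?ltnS.
  by rewrite -mulr_suml bary_total x0 mul1r.
have := ler_distD (f (truncate n x)) (f x) 0; rewrite !subr0.
by move: h2; rewrite ler_norml => /andP[]; lra.
Unshelve. all: by end_near. Qed.

End tower_embedding.

End tower_simplex.

Lemma linfty_tower_copy (R : realType) (X : completeNormedModType R)
    (a : nat -> nat -> R) (u : nat -> nat -> X) : linfty_tower a u ->
  exists S : choquet_simplex R, ~ finite_dimensional (affine_space S) /\
    contains_isometric_copy X (affine_space S).
Proof.
move=> [a_ge0 a_sum u_step u_le u_ge]; exists (bary_simplex a_ge0 a_sum).
split; first exact: bary_simplex_infinite_dimensional.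
exists (linear_of (tower_map_linear u_step u_le)) => f.
exact: tower_map_isometry.
Qed.

(** * Duality with $\ell_1$ *)

Section l1_basics.
Context {R : realType}.
Implicit Types f g : l1 R.

Lemma l1_normE f : (`|f|%:E = \sum_(n <oo) `|f n|%:E)%E.
Proof.
have -> : `|f| = l1_norm f by [].
rewrite /l1_norm fineK// ge0_fin_numE.
  by have := l1_valP f; rewrite inE.
by apply: nneseries_ge0 => n _ _; rewrite lee_fin.
Qed.

Lemma l1_coordD f g n : (f + g) n = f n + g n. Proof. by []. Qed.

Lemma l1_coordN f n : (- f) n = - f n. Proof. by []. Qed.

Lemma l1_coordZ a f n : (a *: f) n = a * f n. Proof. by []. Qed.

Lemma l1_coord_sum (I : Type) (r : seq I) (P : pred I) (F : I -> l1 R) n :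
  (\sum_(i <- r | P i) F i) n = \sum_(i <- r | P i) F i n.
Proof. exact: (big_morph (fun f : l1 R => f n : R)). Qed.

Lemma l1_unit_subproof n : (fun k => (k == n)%:R : R^o) \in @l1_pred R.
Proof.
rewrite inE /=; rewrite (nneseriesD1 (n := n))//= eqxx eseries0 ?adde0.
  by rewrite ltry.
by move=> k _ /= /negPf ->; rewrite normr0.
Qed.

Definition l1_unit n : l1 R := L1 (l1_unit_subproof n).

Lemma l1_unitE n k : l1_unit n k = (k == n)%:R. Proof. by []. Qed.

(** Additivity of the norm over disjoint supports; it turns equality cases of norm estimates into
    statements on single coordinates. *)
Lemma l1_norm_split f n : `|f| = `|f n| + `|f - f n *: l1_unit n|.
Proof.
apply: EFin_inj; rewrite EFinD !l1_normE.
rewrite (nneseriesD1 (n := n))//; congr (_ + _)%E.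
rewrite [RHS](nneseriesD1 (n := n))//.
rewrite [X in _ = (X + _)%E](_ : _ = 0%E); last first.
  by rewrite l1_coordD l1_coordN l1_coordZ l1_unitE eqxx mulr1 subrr normr0.
rewrite add0e; apply: eq_eseriesr => k /negPf kn.
by rewrite l1_coordD l1_coordN l1_coordZ l1_unitE kn mulr0 subr0.
Qed.

Lemma l1_norm_unit n : `|l1_unit n| = 1.
Proof.
rewrite (l1_norm_split _ n) l1_unitE eqxx scale1r subrr normr0 addr0.
by rewrite normr1.
Qed.

Lemma l1_coord_le f n : `|f n| <= `|f|.
Proof. by rewrite (l1_norm_split f n) lerDl. Qed.

Lemma l1_norm_tail f n : `|f - \sum_(i < n) f i *: l1_unit i| =
  `|f| - \sum_(i < n) `|f i|.
Proof.
elim: n => [|n IHn]; first by rewrite !big_ord0 !subr0.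
rewrite !big_ord_recr/= !opprD !addrA -IHn.
set h := f - _; rewrite [in RHS](l1_norm_split h n).
have -> : h n = f n.
  rewrite l1_coordD l1_coordN l1_coord_sum big1 ?subr0// => i _.
  by rewrite l1_coordZ l1_unitE gtn_eqF ?mulr0.
by rewrite [`|f n| + _]addrC addrK.
Qed.

Lemma l1_partial_le f n : \sum_(i < n) `|f i| <= `|f|.
Proof. by rewrite -subr_ge0 -l1_norm_tail. Qed.

Lemma l1_partial_cvg f : (fun n => \sum_(i < n) `|f i|) @ \oo --> `|f|.
Proof.
have : (\sum_(0 <= i < n) `|f i|%:E)%E @[n --> \oo] --> (`|f|%:E)%E.
  rewrite l1_normE; apply: is_cvg_nneseries => i _ _.
  by rewrite lee_fin.
under eq_fun do rewrite sumEFin big_mkord.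
exact: fine_cvg.
Qed.

End l1_basics.

Section dual_basics.
Context {R : realType} {X : normedModType R}.
Implicit Types h : dual X.

Lemma dual_linear_subproof h : linear (h : X -> R^o).
Proof. by have := dual_valP h; rewrite inE => -[]. Qed.

HB.instance Definition _ h :=
  GRing.isLinear.Build R X R^o _ (dual_val h) (dual_linear_subproof h).

Lemma dual_has_ubound h : has_ubound [set `|h x| | x in [set x | `|x| <= 1]].
Proof.
have ch : continuous h by have := dual_valP h; rewrite inE => -[].
have /bounded_funP /(_ 1) [M bM] : bounded_near (dual_val h) (nbhs (0 : X)).
  exact: (@continuous_linear_bounded _ _ _ 0 (dual_val h) (ch 0)).
by exists M => _ [x /= x1 <-]; exact: bM.
Qed.

Lemma dual_apply_le h x : `|h x| <= `|h| * `|x|.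
Proof.
have [->|x0] := eqVneq x 0; first by rewrite linear0 !normr0 mulr0.
have nx : 0 < `|x| by rewrite normr_gt0.
rewrite -ler_pdivrMr//.
have -> : `|h x| / `|x| = `|h (`|x|^-1 *: x)|.
  by rewrite linearZ /= normrM normfV normr_id mulrC.
apply: ub_le_sup; first exact: dual_has_ubound.
exists (`|x|^-1 *: x) => //=.
by rewrite normrZ normfV normr_id mulVf// gt_eqF.
Qed.

Lemma dual_norm_le h (C : R) :
  (forall x, `|x| <= 1 -> `|h x| <= C) -> `|h| <= C.
Proof.
move=> hC; apply: ge_sup; first by exists `|h 0|, 0 => //=; rewrite normr0.
by move=> _ [x /= x1 <-]; exact: hC.
Qed.

Lemma dual_norming h (eps : R) : 0 < eps ->
  exists2 x, `|x| <= 1 & `|h| - eps < h x.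
Proof.
move=> e0; have hs : has_sup [set `|h x| | x in [set x | `|x| <= 1]].
  split; last exact: dual_has_ubound.
  by exists `|h 0|, 0 => //=; rewrite normr0.
have [_ [x /= x1 <-] hx] := sup_adherent e0 hs.
have [h0|h0] := leP 0 (h x); first by exists x => //;
  rewrite (ger0_norm h0) in hx.
by exists (- x); rewrite ?normrN ?linearN//= -(ltr0_norm h0).
Qed.

Lemma bounded_linear_dual (phi : {linear X -> R^o}) (C : R) :
  (forall x, `|phi x| <= C * `|x|) -> exists h, forall x, h x = phi x.
Proof.
move=> phiC; have cphi : continuous phi.
  apply/linear_bounded_continuous/linear_boundedP.
  apply: filterS (nbhs_pinfty_ge (num_real C)) => r Cr x.
  by apply: le_trans (phiC x) _; rewrite ler_wpM2r.
have phiP : (phi : X -> R^o) \in @dual_pred R X.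
  rewrite inE; split=> [a x y|x]; last exact: cphi.
  by rewrite linearP.
by exists (Dual phiP).
Qed.

End dual_basics.

Section predual.
Context {R : realType} {X : completeNormedModType R}.
Context {iota : {linear l1 R -> dual X}}.
Hypothesis iota_isom : isometric_isomorphism iota.
Implicit Types (f g : l1 R) (x y : X).

Lemma iotaZ a f x : iota (a *: f) x = a * iota f x.
Proof. by rewrite linearZ. Qed.

Lemma iotaB f g x : iota (f - g) x = iota f x - iota g x.
Proof. by rewrite linearB. Qed.

Lemma iota_sum (I : Type) (r : seq I) (P : pred I) (F : I -> l1 R) x :
  iota (\sum_(i <- r | P i) F i) x = \sum_(i <- r | P i) iota (F i) x.
Proof.
by rewrite linear_sum; elim/big_rec2: _ => //= i y1 y2 _ <-.
Qed.

Lemma iota_le f x : `|iota f x| <= `|f| * `|x|.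
Proof. by rewrite -(iota_isom.1 f); exact: dual_apply_le. Qed.

Definition coord n x : R^o := iota (l1_unit n) x.

Lemma coord_linear_subproof n : linear (coord n).
Proof. by move=> a x y; rewrite /coord linearP. Qed.

HB.instance Definition _ n :=
  GRing.isLinear.Build R X R^o _ (coord n) (coord_linear_subproof n).

Arguments coord : simpl never.

Lemma coord0 n : coord n 0 = 0. Proof. exact: linear0. Qed.

Lemma coordN n x : coord n (- x) = - coord n x. Proof. exact: linearN. Qed.

Lemma coordD n x y : coord n (x + y) = coord n x + coord n y.
Proof. exact: linearD. Qed.

Lemma coordB n x y : coord n (x - y) = coord n x - coord n y.
Proof. exact: linearB. Qed.

Lemma coordZ n (a : R) x : coord n (a *: x) = a * coord n x.
Proof. exact: linearZ. Qed.

Lemma coord_sum n (I : Type) (r : seq I) (P : pred I) (F : I -> X) :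
  coord n (\sum_(i <- r | P i) F i) = \sum_(i <- r | P i) coord n (F i).
Proof. exact: linear_sum. Qed.

Lemma coord_le n x : `|coord n x| <= `|x|.
Proof. by have := iota_le (l1_unit n) x; rewrite l1_norm_unit mul1r. Qed.

Lemma iota_split f n x :
  iota f x = f n * coord n x + iota (f - f n *: l1_unit n) x.
Proof. by rewrite iotaB iotaZ [RHS]addrC subrK. Qed.

(** The remainder is the image of a tail of [f], whose norm tends to 0. *)
Lemma iota_cvg f x : (fun n => \sum_(i < n) f i * coord i x) @ \oo --> iota f x.
Proof.
apply/cvgrPdist_le => e e0; have fc := @l1_partial_cvg _ f.
(* The summand 1 prevents a zero denominator when [x] is 0. *)
have d0 : 0 < e / (`|x| + 1) by rewrite divr_gt0// ltr_wpDl.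
move/cvgrPdist_le : fc => /(_ _ d0) fc; near=> n.
have -> : iota f x - \sum_(i < n) f i * coord i x =
    iota (f - \sum_(i < n) f i *: l1_unit i) x.
  by rewrite iotaB iota_sum; congr (_ - _); apply: eq_bigr => i _;
    rewrite iotaZ.
apply: le_trans (iota_le _ _) _; rewrite l1_norm_tail.
have : `|f| - \sum_(i < n) `|f i| <= e / (`|x| + 1).
  by apply: le_trans (ler_norm _) _; near: n.
rewrite ler_pdivlMr ?ltr_wpDl//; apply: le_trans.
by rewrite ler_wpM2l// ?subr_ge0 ?l1_partial_le// lerDl.
Unshelve. all: by end_near. Qed.

Lemma bounded_linear_iota (phi : {linear X -> R^o}) (C : R) :
  (forall x, `|phi x| <= C * `|x|) -> exists f, forall x, iota f x = phi x.
Proof.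
by move=> /bounded_linear_dual [h hE]; have [f fh] := iota_isom.2 h; exists f;
  rewrite fh.
Qed.

Lemma iota_inj f g : (forall x, iota f x = iota g x) -> f = g.
Proof.
move=> fg; apply/eqP; rewrite -subr_eq0 -normr_eq0 -(iota_isom.1).
rewrite normr_eq0; apply/eqP/val_inj/funext => x.
by apply: etrans (iotaB f g x) _; rewrite fg subrr.
Qed.

(** Hahn-Banach extension from the line through [x], dominated by the norm. *)
Lemma norming_functional x : exists2 f : l1 R, `|f| <= 1 & iota f x = `|x|.
Proof.
pose G := [set (t *: x, t * `|x| : R^o) | t in [set: R]].
have [||||phi [phiN phix]] := @hahn_banach R X (fun y => `|y|) _ _ G.
- exact: ler_normD.
- by move=> t y t0; rewrite normrZ ger0_norm.
- split; first by exists (0 *: x, 0 * `|x|), 0.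
  move=> a _ _ [s _ <-] [t _ <-]; exists (a * s + t) => //.
  by congr (_, _) => /=; [rewrite scalerDl scalerA|rewrite mulrDl -mulrA].
- move=> _ _ [t _ [<- <-]]; rewrite normrZ ler_wpM2r//; exact: ler_norm.
have phiB y : `|phi y| <= 1 * `|y|.
  rewrite mul1r ler_norml phiN andbT lerNl -linearN/=.
  by rewrite (le_trans (phiN _))// normrN.
have [f fE] := bounded_linear_iota phiB.
exists f; last by rewrite fE; apply: phix; exists 1 => //;
  rewrite scale1r mul1r.
rewrite -(iota_isom.1); apply: dual_norm_le => y y1.
by rewrite fE (le_trans (phiB y))// mul1r.
Qed.

(** Equality for the whole of [f] leaves no slack: splitting off coordinate [n], both parts must
    attain their bounds. *)
Lemma norming_coord f x n : `|f| <= 1 -> iota f x = `|x| ->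
  f n * coord n x = `|f n| * `|x|.
Proof.
move=> f1 fx; apply/le_anti/andP; split.
  apply: le_trans (ler_norm _) _; rewrite normrM ler_wpM2l//; exact: coord_le.
have := iota_le (f - f n *: l1_unit n) x; have := iota_split f n x.
rewrite fx; have := l1_norm_split f n; set h := f - _ => f2 xE.
rewrite ler_norml => /andP[_ hx].
have : `|f| * `|x| <= `|x| by rewrite ler_piMl.
by rewrite f2 mulrDl; lra.
Qed.

(** Any coordinate in the support of a norming functional attains the norm, so the norm of [X] is a
    maximum over coordinates. *)
Lemma norm_attained x : exists n : nat, `|coord n x| = `|x|.
Proof.
have [->|x0] := eqVneq x 0; first by exists 0%N; rewrite linear0 !normr0.
have [f f1 fx] := norming_functional x.
have [n fn] : exists n, f n != 0.
  apply: contrapT => /forallNP f0; move: fx; rewrite (_ : f = 0).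
    by rewrite linear0 => /esym/eqP; rewrite normr_eq0 (negPf x0).
  by apply/val_inj/funext => n; apply/eqP; apply: contrapT => /negP; exact: f0.
exists n; have /(congr1 Num.norm) := norming_coord n f1 fx.
rewrite !normrM !normr_id => /mulfI; apply; by rewrite normr_eq0.
Qed.

Lemma norm_le_coord x (M : R) : (forall n, `|coord n x| <= M) -> `|x| <= M.
Proof. by move=> xM; have [n <-] := norm_attained x. Qed.

(** * Intersections of balls *)

(** Such an [f] acts as a combination of the coordinates in [s], hence equals the same combination
    of unit vectors. *)
Lemma coord_unit_supp (s : seq nat) f :
  (forall x, (forall k, k \in s -> coord k x = 0) -> iota f x = 0) ->
  forall k, k \notin s -> f k = 0.
Proof.
move=> f0 k ks; have us := undup_uniq s.
have [|c cE] := linear_form_span (e := fun n => coord n : {linear X -> R^o})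
    (f := dual_val (iota f)) us.
  by move=> x xs; apply: f0 => i; rewrite -mem_undup => /xs.
have -> : f = \sum_(i <- undup s) c i *: l1_unit i.
  apply: iota_inj => x; rewrite cE iota_sum; apply: eq_bigr => i _.
  by rewrite iotaZ.
rewrite l1_coord_sum big_seq big1// => i; rewrite mem_undup => si.
rewrite l1_coordZ l1_unitE; case: eqP => [ki|_]; last by rewrite mulr0.
by rewrite ki si in ks.
Qed.

(** The coordinates are linearly independent: by [coord_unit_supp], a new one does not vanish on the
    common kernel of the others. *)
Lemma coord_interpolation (s : seq nat) (v : nat -> R) :
  exists x, forall k, k \in s -> coord k x = v k.
Proof.
elim: s => [|j s [x xs]]; first by exists 0.
have [js|js] := boolP (j \in s).
  by exists x => k; rewrite inE => /predU1P[->|]; exact: xs.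
have [z zs zj] : exists2 z,
    (forall k, k \in s -> coord k z = 0) & coord j z != 0.
  apply: contrapT => /forall2NP noz.
  have jker y : (forall k, k \in s -> coord k y = 0) -> coord j y = 0.
    by move=> ys; apply/eqP; apply: contrapT => /negP jy;
      have [/(_ ys)|] := noz y.
  have := coord_unit_supp jker js; rewrite l1_unitE eqxx => /eqP.
  by rewrite oner_eq0.
exists (x + ((v j - coord j x) / coord j z) *: z) => k.
rewrite inE coordD coordZ => /predU1P[->|ks].
  by rewrite divfK// addrC subrK.
by rewrite (xs _ ks) (zs _ ks) mulr0 addr0.
Qed.

Section ball_intersection.
Context {I : finType}.
Variables (x : I -> X) (r : I -> R) (s : seq nat) (v : nat -> R).
Hypothesis xr : forall i j, `|x i - x j| <= r i + r j.
Hypothesis vr : forall k i, k \in s -> `|v k - coord k (x i)| <= r i.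

Let r_ge0 i : 0 <= r i.
Proof. by have := xr i i; rewrite subrr normr0; lra. Qed.

(* Outside [s] the coefficients of the [f i] add up to 0, so that [y0] may be
   replaced there, coordinate by coordinate, by any real number that is close
   enough to all the [x i]; Helly's theorem on the line provides one. *)
Lemma separation_le (f : I -> l1 R) y0 :
  (forall k, k \in s -> coord k y0 = v k) ->
  (forall k, k \notin s -> \sum_i f i k = 0) ->
  \sum_i iota (f i) (y0 - x i) <= \sum_i r i * `|f i|.
Proof.
move=> y0s f0.
have cv : (fun n => \sum_i \sum_(k < n) f i k * coord k (y0 - x i)) @ \oo -->
    \sum_i iota (f i) (y0 - x i).
  by apply: (@cvg_sumr R R^o) => i _; exact: iota_cvg.
rewrite -(cvg_lim (@Rhausdorff R) cv); apply: limr_le.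
  by apply/cvg_ex; eexists; exact: cv.
apply: nearW => n; rewrite exchange_big/=.
apply: (@le_trans _ _ (\sum_(k < n) \sum_i r i * `|f i k|)); last first.
  rewrite exchange_big/=; apply: ler_sum => i _; rewrite -mulr_sumr.
  by apply: ler_wpM2l; rewrite ?r_ge0//; exact: l1_partial_le.
apply: ler_sum => k _; have [i0 _|I0] := pickP I; last first.
  by rewrite !big1// => i; have := I0 i.
have [t tk tx] : exists2 t, \sum_i f i k * (coord k y0 - t) = 0 &
    forall i, `|t - coord k (x i)| <= r i.
  have [ks|ks] := boolP (nat_of_ord k \in s).
    exists (v k) => [|i]; last exact: vr.
    by rewrite (y0s _ ks) subrr big1// => i _; rewrite mulr0.
  have [i j|t tx] := @interval_helly _ _ (fun i => coord k (x i)) r i0.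
    by rewrite -coordB; apply: le_trans (coord_le _ _) (xr _ _).
  by exists t => //; rewrite -mulr_suml f0// mul0r.
rewrite (eq_bigr (fun i =>
    f i k * (coord k y0 - t) + f i k * (t - coord k (x i)))).
  rewrite big_split/= tk add0r; apply: ler_sum => i _.
  by rewrite (le_trans (ler_norm _))// normrM [leRHS]mulrC ler_wpM2l// tx.
by move=> i _; rewrite coordB -mulrDr addrA subrK.
Qed.

(** If no admissible [y] existed, Hahn-Banach in the power of [X] indexed by [I] would separate the
    tuples [y - x i] from the product of the enlarged balls, which contradicts [separation_le]. *)
Lemma ball_intersection_approx (eps : R) : 0 < eps ->
  exists2 y, (forall k, k \in s -> coord k y = v k) &
    forall i, `|y - x i| <= r i + eps.
Proof.
move=> eps0; apply: contrapT => /forall2NP noy.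
have far y : (forall k, k \in s -> coord k y = v k) ->
    exists i, r i + eps < `|y - x i|.
  move=> ys; have [/(_ ys)//|/existsNP[i]] := noy y.
  by move/negP; rewrite -ltNge; exists i.
have [y0 y0s] := coord_interpolation s v.
have rho0 i : 0 < r i + eps by rewrite ltr_wpDl.
(* The gauge of the product of the balls of radii [r i + eps] around 0. *)
pose p (y : {ffun I -> X}) : R := \big[Num.max/0]_i (`|y i| / (r i + eps)).
have p0 (y : {ffun I -> X}) : 0 <= p y by exact: bigmax_ge_id.
have py (y : {ffun I -> X}) i : `|y i| <= p y * (r i + eps).
  by rewrite -ler_pdivrMr//; apply: le_bigmax.
have p_le (y : {ffun I -> X}) (M : R) :
    0 <= M -> (forall i, `|y i| <= M * (r i + eps)) -> p y <= M.
  by move=> M0 yM; apply/bigmax_leP; split=> // i _; rewrite ler_pdivrMr.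
have pD (y z : {ffun I -> X}) : p (y + z) <= p y + p z.
  apply: p_le => [|i]; first by rewrite addr_ge0.
  by rewrite ffunE (le_trans (ler_normD _ _))// mulrDl lerD.
have pZ (t : R) (y : {ffun I -> X}) : 0 <= t -> p (t *: y) = t * p y.
  move=> t0; have pZle (a : R) (z : {ffun I -> X}) :
      0 <= a -> p (a *: z) <= a * p z.
    move=> a0; apply: p_le => [|i]; first by rewrite mulr_ge0.
    by rewrite ffunE normrZ ger0_norm// -mulrA ler_wpM2l.
  have [->|t1] := eqVneq t 0.
    by apply/le_anti; rewrite pZle//= mul0r.
  have t2 : 0 < t by rewrite lt_def t1.
  apply/le_anti; rewrite pZle//= -ler_pdivlMl//.
  rewrite -{1}[y]scale1r -(mulVf t1) -scalerA.
  by apply: pZle; rewrite invr_ge0.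
(* The form to extend takes the value [t] at the tuple [z + t *: (y0 - x i)], for [z] in the common
   kernel; it is dominated because no admissible point is near all centres. *)
pose G0 := [set yt : {ffun I -> X} * R^o | exists2 z,
  (forall k, k \in s -> coord k z = 0) &
  yt.1 = [ffun i => z + yt.2 *: (y0 - x i)]].
have lG0 : linear_graph G0.
  split.
    exists 0, 0; first by move=> k _; rewrite coord0.
    by apply/ffunP => i; rewrite !ffunE scale0r addr0.
  move=> a [_ t] [_ t'] [z zs /= ->] [z' z's /= ->]; exists (a *: z + z').
    by move=> k ks; rewrite coordD coordZ zs// z's// mulr0 addr0.
  apply/ffunP => i; rewrite !ffunE/=.
  by rewrite scalerDr scalerDl -scalerA addrACA.
have dG0 : dominated_graph p G0.
  move=> y t [z zs /= yE]; have [t0|t0] := leP t 0; first exact: le_trans t0 _.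
  have [k ks|i hi] := far (t^-1 *: z + y0).
    by rewrite coordD coordZ zs// mulr0 add0r y0s.
  rewrite -(ler_pM2r (rho0 i)); apply: le_trans (py y i); rewrite yE ffunE.
  have -> : z + t *: (y0 - x i) = t *: (t^-1 *: z + y0 - x i).
    by rewrite -[in RHS]addrA [RHS]scalerDr scalerA divff ?gt_eqF// scale1r.
  by rewrite normrZ gtr0_norm// ler_pM2l// ltW.
have [Phi [Phip PhiE]] := hahn_banach pD pZ lG0 dG0.
pose emb i (y : X) : {ffun I -> X} := [ffun j => if j == i then y else 0].
have embl i : linear (fun y => Phi (emb i y)).
  move=> a y z; rewrite -linearP; congr (Phi _).
  by apply/ffunP => j; rewrite !ffunE; case: ifP => // _; rewrite scaler0 addr0.
have PhiS (y : {ffun I -> X}) : Phi y = \sum_i Phi (emb i (y i)).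
  rewrite -linear_sum; congr (Phi _); apply/ffunP => j; rewrite sum_ffunE.
  rewrite (bigD1 j)//= ffunE eqxx big1 ?addr0// => i /negPf ij.
  by rewrite ffunE eq_sym ij.
have embB i (y : X) : `|linear_of (embl i) y| <= (r i + eps)^-1 * `|y|.
  have pe z : p (emb i z) <= (r i + eps)^-1 * `|z|.
    apply: p_le => [|j]; first by rewrite mulr_ge0 ?invr_ge0// ltW.
    rewrite ffunE; case: eqP => [->|_];
      first by rewrite mulrAC mulVf ?mul1r ?gt_eqF.
    by rewrite normr0 !mulr_ge0 ?invr_ge0// ltW.
  rewrite ler_norml -[X in _ && X]/(Phi (emb i y) <= _).
  rewrite (le_trans (Phip _))// andbT lerNl -linearN.
  by rewrite -[leLHS]/(Phi (emb i (- y))) (le_trans (Phip _))// -(normrN y).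
have /choice[f fE] i := bounded_linear_iota (embB i).
have PhiW : Phi [ffun i => y0 - x i] = 1.
  apply: PhiE; exists 0; first by move=> k _; rewrite coord0.
  by apply/ffunP => i; rewrite !ffunE scale1r add0r.
have fs k : k \notin s -> \sum_i f i k = 0.
  move=> ks; rewrite -l1_coord_sum; apply: (coord_unit_supp _ ks) => z zs.
  rewrite iota_sum; transitivity (Phi [ffun i => z]).
    by rewrite PhiS; apply: eq_bigr => i _; rewrite fE ffunE.
  apply: PhiE; exists z => //.
  by apply/ffunP => i; rewrite !ffunE scale0r addr0.
(* A bound on the dual norm of [Phi], obtained by testing each [f i] on an almost norming [z i]. *)
have fle : \sum_i (r i + eps) * `|f i| <= 1.
  apply/ler_addgt0Pr => d d0.
  have rs : 0 < \sum_i (r i + eps) + 1.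
    by rewrite ltr_wpDl// sumr_ge0// => i _; exact: ltW.
  pose d' := d / (\sum_i (r i + eps) + 1).
  have d'0 : 0 < d' by rewrite divr_gt0.
  have /choice[z zE] i : exists z : X,
      `|z| <= 1 /\ `|iota (f i)| - d' < iota (f i) z.
    by have [z z1 fz] := dual_norming (iota (f i)) d'0; exists z.
  have pz1 : p [ffun i => (r i + eps) *: z i] <= 1.
    apply: p_le => // i; rewrite ffunE normrZ gtr0_norm// mul1r ler_piMr
      ?(ltW (rho0 i))//.
    by have [] := zE i.
  have := le_trans (Phip _) pz1; rewrite PhiS.
  have -> : \sum_i Phi (emb i ([ffun i => (r i + eps) *: z i] i)) =
      \sum_i (r i + eps) * iota (f i) (z i).
    by apply: eq_bigr => i _; rewrite ffunE -linearZ/= fE.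
  have sumd : (\sum_i (r i + eps)) * d' <= d.
    by rewrite /d' mulrA ler_pdivrMr// mulrC ler_pM2l// lerDl.
  move=> le1; have : \sum_i (r i + eps) * `|f i| <=
      \sum_i ((r i + eps) * iota (f i) (z i) + (r i + eps) * d').
    apply: ler_sum => i _; rewrite -mulrDr ler_pM2l// -lerBlDr.
    by have [_ /ltW] := zE i; rewrite iota_isom.1.
  by rewrite big_split/= -mulr_suml; lra.
have := separation_le y0s fs.
have W1 : \sum_i iota (f i) (y0 - x i) = 1.
  by rewrite -PhiW PhiS; apply: eq_bigr => i _; rewrite fE ffunE.
have fx0 : 0 <= \sum_i `|f i| by exact: sumr_ge0.
(* By separation the sum with the radii [r i] is already at least 1, so the extra [eps] forces every
   [f i] to vanish, contrary to [W1]. *)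
move: fle; under eq_bigr do rewrite mulrDl.
rewrite big_split/= -mulr_sumr => le1 le2.
have {}fx0 : \sum_i `|f i| = 0.
  apply/le_anti; rewrite fx0 andbT -(ler_pM2l eps0) mulr0.
  by move: le2; rewrite W1; move: le1; lra.
have f0 i : f i = 0.
  by apply/eqP; rewrite -normr_eq0; apply/eqP; apply: (psumr_eq0P _ fx0).
move: W1; rewrite big1 => [/esym/eqP|i _]; first by rewrite oner_eq0.
by rewrite f0 linear0.
Qed.

End ball_intersection.

(** Successive approximation: the errors [eps n] decrease geometrically and the approximate points
    converge. *)
Lemma ball_intersection (I : finType) (x : I -> X) (r : I -> R) (s : seq nat)
    (v : nat -> R) : (forall i j, `|x i - x j| <= r i + r j) ->
  (forall k i, k \in s -> `|v k - coord k (x i)| <= r i) ->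
  exists2 y, (forall k, k \in s -> coord k y = v k) &
    forall i, `|y - x i| <= r i.
Proof.
move=> xr vr; pose eps n : R := 2^-1 ^+ n.
have eps0 n : 0 < eps n by rewrite exprn_gt0// invr_gt0.
pose P n y := (forall k, k \in s -> coord k y = v k) /\
  forall i, `|y - x i| <= r i + eps n.
have [y0 y0s y0x] := ball_intersection_approx xr vr (eps0 0%N).
have [||u [_ uP uQ]] := @sequence_choice _ P
    (fun n y z => `|z - y| <= 2 * eps n) y0.
- by [].
- move=> n y [ys yx].
  (* The current point becomes one more centre, of radius [eps n], which keeps the next point within
     [2 * eps n]. *)
  pose x' i := if i is Some j then x j else y.
  pose r' i := if i is Some j then r j else eps n.
  have [||z zs zx] := @ball_intersection_approx _ x' r' s v _ _ _ (eps0 n.+1).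
  + move=> [i|] [j|] //=; last by rewrite subrr normr0 addr_ge0// ltW.
      by rewrite distrC.
    by rewrite [leRHS]addrC.
  + move=> k [i|] ks /=; first exact: vr.
    by rewrite ys// subrr normr0 ltW.
  exists z; first by split=> // i; exact: zx (Some i).
  have := zx None; rewrite /= /eps exprS; have := eps0 n; rewrite /eps; lra.
have /cvg_ex[y uy] := cvgn_geometric_step uQ.
have near_y e : 0 < e -> exists n, `|y - u n| <= e /\ eps n <= e.
  move=> e0; have epsc : eps n @[n --> \oo] --> 0.
    by apply: cvg_expr; rewrite ger0_norm ?invf_lt1 ?ltr1n.
  move/cvgrPdist_le : uy => /(_ _ e0) uy.
  move/cvgrPdist_le : epsc => /(_ _ e0) epsc.
  near \oo => n; exists n; split; first by near: n.
  have : `|0 - eps n| <= e by near: n.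
  by rewrite sub0r normrN gtr0_norm.
exists y => [k ks|i].
  apply/eqP; rewrite -subr_eq0 -normr_le0; apply/ler_addgt0Pr => e e0.
  have [n [yn _]] := near_y _ e0; rewrite add0r.
  have [us _] := uP n; rewrite -(us k ks) -coordB.
  exact: le_trans (coord_le _ _) _.
apply/ler_addgt0Pr => e e0; have e2 : 0 < e / 2 by rewrite divr_gt0.
have [n [yn en]] := near_y _ e2; have [_ /(_ i) ux] := uP n.
have := ler_distD (u n) y (x i); lra.
Unshelve. all: by end_near. Qed.

(** * Peaked partitions *)

Section peaked_partitions.
Variables (j : nat -> nat) (sg : nat -> R) (x0 : X).
Hypothesis j_inj : injective j.
Hypothesis sg1 : forall k, sg k * sg k = 1.
Hypothesis x0_le1 : `|x0| <= 1.
Hypothesis x0_sg : forall k, sg k * coord (j k) x0 = 1.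

(** The signs make all these coordinates equal to 1 at [x0]. *)
Definition signed_coord k x : R := sg k * coord (j k) x.
Local Notation d := signed_coord.

Let sg_norm k : `|sg k| = 1.
Proof.
by apply/eqP; rewrite -sqrp_eq1// -normrX expr2 sg1 normr1.
Qed.

Let d_norm k x : `|d k x| = `|coord (j k) x|.
Proof. by rewrite normrM sg_norm mul1r. Qed.

Let dD k x y : d k (x + y) = d k x + d k y.
Proof. by rewrite /d coordD mulrDr. Qed.

Let dZ k (a : R) x : d k (a *: x) = a * d k x.
Proof. by rewrite /d coordZ mulrCA. Qed.

Let d_sum k (n : nat) (F : 'I_n -> X) :
  d k (\sum_(i < n) F i) = \sum_(i < n) d k (F i).
Proof. by rewrite /d coord_sum mulr_sumr. Qed.

(** The first condition bounds the norm of a combination of the [u k] from above by its largest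
    coefficient, the second from below. *)
Definition peaked_partition n (u : nat -> X) :=
  [/\ forall i, \sum_(k < n.+1) `|coord i (u k)| <= 1,
      forall l k, (l <= n)%N -> (k <= n)%N -> d l (u k) = (l == k)%:R &
      \sum_(k < n.+1) u k = x0].

Section refinement.
Variables (n : nat) (u : nat -> X).
Hypothesis u_part : peaked_partition n u.

Let a k := d n.+1 (u k).

Lemma peaked_partition_weight_sum : \sum_(k < n.+1) a k = 1.
Proof. by have [_ _ ux] := u_part; rewrite /a -d_sum ux; exact: x0_sg. Qed.

(** The weights have sum 1 and absolute sum at most 1, so each equals its absolute value. *)
Lemma peaked_partition_weight_ge0 k : (k <= n)%N -> 0 <= a k.
Proof.
move=> kn; have [/(_ (j n.+1)) u1 _ _] := u_part.
have : \sum_(k < n.+1) (`|a k| - a k) <= 0.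
  by rewrite sumrB peaked_partition_weight_sum subr_le0;
    under eq_bigr do rewrite d_norm.
rewrite (bigD1 (Ordinal (kn : (k < n.+1)%N)))//= => h.
have : 0 <= \sum_(i < n.+1 | i != Ordinal (kn : (k < n.+1)%N)) (`|a i| - a i).
  by apply: sumr_ge0 => i _; rewrite subr_ge0 ler_norm.
have := normr_ge0 (a k); lra.
Qed.

(* Developing the absolute values over the sign vectors [th], the last condition
   says that [|m x' + w| <= 1] for [w = sum_k th_k u_k] and
   [m = 1 - sum_k th_k a_k]: finitely many balls, which all contain 0. *)
Lemma peak_exists : exists x', [/\ d n.+1 x' = 1,
  forall l, (l <= n)%N -> d l x' = 0 &
  forall i, `|coord i x'| +
    \sum_(k < n.+1) `|coord i (u k) - a k * coord i x'| <= 1].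
Proof.
have [u1 ud ux] := u_part; have a_sum := peaked_partition_weight_sum.
pose I := {ffun 'I_n.+1 -> bool}.
pose th (b : I) k : R := if b k then 1 else -1.
have thN b k : `|th b k| = 1 by rewrite /th; case: ifP; rewrite ?normrN normr1.
pose m b := 1 - \sum_(k < n.+1) th b k * a k.
pose w b := \sum_(k < n.+1) th b k *: u k.
have m_ge0 b : 0 <= m b.
  rewrite subr_ge0 -a_sum; apply: ler_sum => k _.
  apply: le_trans (ler_norm _) _.
  by rewrite normrM thN mul1r ger0_norm// peaked_partition_weight_ge0// -ltnS.
have w1 b i : `|coord i (w b)| <= 1.
  apply: le_trans (u1 i); rewrite coord_sum;
    apply: le_trans (ler_norm_sum _ _ _) _.
  by apply: ler_sum => k _; rewrite coordZ normrM thN mul1r.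
(* If [m b] is 0, then so is its inverse, and the ball becomes the unit ball around 0; the condition
   to be met is then just [w1]. *)
pose c b := - ((m b)^-1 *: w b).
pose r b := if m b == 0 then 1 else (m b)^-1.
have cr b : `|c b| <= r b.
  apply: norm_le_coord => i; rewrite coordN normrN coordZ /r.
  case: eqP => [->|_]; first by rewrite invr0 mul0r normr0.
  by rewrite normrM ger0_norm ?invr_ge0// ler_piMr ?invr_ge0.
pose v i := if i == j n.+1 then sg n.+1 else 0.
have [||x' x's x'c] := @ball_intersection I c r (map j (seq.iota 0 n.+2)) v.
- by move=> b b'; apply: le_trans (ler_normB _ _) _; rewrite lerD.
- move=> _ b /mapP[l _ ->]; rewrite /v; case: eqP => [->|_].
    have -> : `|sg n.+1 - coord (j n.+1) (c b)| = `|1 - d n.+1 (c b)|.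
      by rewrite -[LHS]mul1r -{1}(sg_norm n.+1) -normrM mulrBr sg1.
    (* As [d n.+1 (w b)] is [1 - m b], the prescribed value lies at distance exactly [r b] from the
       value at the centre. *)
    have -> : d n.+1 (c b) = - ((m b)^-1 * (1 - m b)).
      rewrite /c -scaleN1r dZ dZ mulN1r /w d_sum; congr (- (_ * _)).
      by rewrite subKr; apply: eq_bigr => k _; rewrite dZ.
    rewrite opprK /r; case: eqP => [->|/eqP m0].
      by rewrite invr0 mul0r addr0 normr1.
    by rewrite mulrBr mulVf// mulr1 addrC subrK ger0_norm// invr_ge0.
  by rewrite sub0r normrN (le_trans (coord_le _ _)).
exists x'; split.
- rewrite /d x's ?map_f ?mem_iota ?add0n ?leqnn//.
  by rewrite /v eqxx.
- move=> l ln; rewrite /d x's ?map_f ?mem_iota ?add0n ?ltnS ?leqW//.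
  by rewrite /v (inj_eq j_inj) ltn_eqF ?mulr0// ltnS.
move=> i; set t := coord i x'.
pose e k := coord i (u k) - a k * t.
(* These signs give every term [th b k * e k] the sign of [t], so that the absolute values add
   up. *)
pose b : I := [ffun k : 'I_n.+1 => (0 <= t) == (0 <= e k)].
have main : `|m b * t + coord i (w b)| <= 1.
  have [m0|m0] := eqVneq (m b) 0; first by rewrite m0 mul0r add0r.
  have m1 : 0 < m b by rewrite lt_def m0 m_ge0.
  have := le_trans (coord_le i (x' - c b)) (x'c b).
  rewrite /r (negPf m0) -(ler_pM2l m1) divff// coordB coordN coordZ opprK -/t.
  by rewrite -{1}(ger0_norm (m_ge0 b)) -normrM mulrDr mulVKf.
apply: le_trans main.
have -> : m b * t + coord i (w b) = t + \sum_(k < n.+1) th b k * e k.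
  rewrite /m mulrBl mul1r -addrA; congr (_ + _).
  rewrite addrC coord_sum mulr_suml -sumrB; apply: eq_bigr => k _.
  by rewrite coordZ /e; ring.
pose tau : R := if 0 <= t then 1 else -1.
have -> : `|t + \sum_(k < n.+1) th b k * e k| =
  `|tau * (t + \sum_(k < n.+1) th b k * e k)|.
  by rewrite normrM /tau; case: ifP; rewrite ?normrN normr1 mul1r.
apply: le_trans (ler_norm _); rewrite mulrDr mulr_sumr; apply: lerD.
  rewrite /tau; case: ifPn => [t0|]; first by rewrite mul1r ger0_norm.
  by rewrite -ltNge => t0; rewrite mulN1r ltr0_norm.
apply: ler_sum => k _; rewrite /tau /th ffunE -/(e k).
case: ifPn => [t0|]; last rewrite -ltNge => t0.
  by rewrite eq_sym eqb_id mul1r; case: ifPn => [e0|]; [rewrite mul1r ger0_norm|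
    rewrite -ltNge => e0; rewrite mulN1r ltr0_norm].
by case: (leP 0 (e k)) => e0 /=; rewrite !mulN1r ?opprK ?mul1r;
  [rewrite ger0_norm|rewrite ltr0_norm].
Qed.

End refinement.

(** The peak [x'] is the new element and each [u k] gives up its share of it; the shares add up to
    [x'], which keeps the sum equal to [x0]. *)
Lemma peaked_partition_refine n u : peaked_partition n u ->
  exists2 u', peaked_partition n.+1 u' &
    forall k, (k <= n)%N -> u k = u' k + d n.+1 (u k) *: u' n.+1.
Proof.
move=> u_part; have [u1 ud ux] := u_part.
have [x' [x'1 x'0 x'i]] := peak_exists u_part.
pose u' k := if k == n.+1 then x' else u k - d n.+1 (u k) *: x'.
have u'n : u' n.+1 = x' by rewrite /u' eqxx.
have u'k k : (k <= n)%N -> u' k = u k - d n.+1 (u k) *: x'.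
  by move=> kn; rewrite /u' ltn_eqF.
have u'o (k : 'I_n.+1) : u' k = u k - d n.+1 (u k) *: x'.
  by rewrite u'k// -ltnS.
exists u'; last by move=> k kn; rewrite u'k// u'n subrK.
split.
- move=> i; rewrite big_ord_recr/= u'n addrC.
  apply: le_trans (x'i i); rewrite lerD2l; apply: ler_sum => k _.
  by rewrite u'o coordB coordZ.
- move=> l k; rewrite leq_eqVlt ltnS => /predU1P[->|ln].
    rewrite leq_eqVlt ltnS => /predU1P[->|kn]; first by rewrite u'n eqxx x'1.
    rewrite u'k// -scaleNr dD dZ x'1 mulr1 subrr eq_sym ltn_eqF//.
  rewrite leq_eqVlt ltnS => /predU1P[->|kn].
    by rewrite u'n x'0// ltn_eqF.
  by rewrite u'k// -scaleNr dD dZ x'0// mulr0 addr0 ud.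
- rewrite big_ord_recr/= u'n -[RHS]ux.
  under eq_bigr do rewrite u'o.
  rewrite sumrB -scaler_suml.
  by rewrite (peaked_partition_weight_sum u_part) scale1r subrK.
Qed.

(** The refinements start from the one-element partition [x0]. The upper norm estimate holds at
    every coordinate, the lower one is read off at [j l]. *)
Lemma peaked_partition_tower : exists a u, @linfty_tower R X a u.
Proof.
have [||u [_ uP uQ]] := @sequence_choice _ peaked_partition
    (fun n u u' => forall k, (k <= n)%N -> u k = u' k + d n.+1 (u k) *: u' n.+1)
    (fun=> x0).
- split=> [i|l k|].
  + by rewrite big_ord1 (le_trans (coord_le _ _)).
  + by rewrite !leqn0 => /eqP-> /eqP->; rewrite eqxx; exact: x0_sg.
  + by rewrite big_ord1.
- by move=> n u /peaked_partition_refine.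
exists (fun n k => d n.+1 (u n k)), u; split.
- by move=> n k; exact: peaked_partition_weight_ge0.
- by move=> n; exact: peaked_partition_weight_sum.
- by move=> n k /uQ.
- move=> n y M M0 yM; have [u1 _ _] := uP n.
  apply: norm_le_coord => i; rewrite coord_sum.
  apply: le_trans (ler_norm_sum _ _ _) _.
  apply: (@le_trans _ _ (\sum_(k < n.+1) M * `|coord i (u n k)|)).
    apply: ler_sum => k _; rewrite coordZ normrM ler_wpM2r//.
    by apply: yM; rewrite -ltnS.
  by rewrite -mulr_sumr ler_piMr.
- move=> n y l ln; have [_ ud _] := uP n.
  apply: le_trans (coord_le (j l) _); rewrite -d_norm d_sum.
  rewrite (bigD1 (Ordinal (ln : (l < n.+1)%N)))//= dZ ud// eqxx mulr1.
  rewrite big1 ?addr0// => k kl; rewrite dZ ud ?mulr0// -1?ltnS//.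
  have /negPf -> : l != k by apply: contra kl => /eqP kl; apply/eqP/val_inj.
  by rewrite mulr0.
Qed.

End peaked_partitions.

(** * Weak* cluster points *)

Lemma sqr_norm1 (s : R) : `|s| = 1 -> s * s = 1.
Proof. by move=> s1; rewrite -expr2 -(real_normK (num_real s)) s1 expr1n. Qed.

(** If [0 < |f n| < 1], then [f] is a proper convex combination of a signed unit vector and the
    rescaled remainder; 0 is the midpoint of two opposite unit vectors. *)
Lemma l1_ball_extreme_unit f : extreme_points [set f : l1 R | `|f| <= 1] f ->
  exists n s, `|s| = 1 /\ f = s *: l1_unit n.
Proof.
move=> [/= f1 fext]; have [n fn] : exists n, f n != 0.
  apply: contrapT => /forallNP f0; have {}f0 : f = 0.
    by apply/val_inj/funext => n; apply/eqP; apply: contrapT => /negP;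
      exact: f0.
  have h : 0 < (2^-1 : R) < 1 by rewrite invr_gt0 ltr0n invf_lt1 ?ltr1n.
  have [||//|u0 _] := fext (l1_unit 0) (- l1_unit 0) 2^-1 _ _ h.
  - by rewrite l1_norm_unit.
  - by rewrite normrN l1_norm_unit.
  - by rewrite f0 {2}[1](splitr 1) div1r addrK scalerN subrr.
  by have := l1_norm_unit (R := R) 0; rewrite u0 f0 normr0 => /esym/eqP;
    rewrite oner_eq0.
have t0 : 0 < `|f n| by rewrite normr_gt0.
have fs := l1_norm_split f n.
have sE : f n = `|f n| * (f n / `|f n|) by rewrite mulrC divfK ?gt_eqF.
have s1 : `|f n / `|f n| | = 1.
  by rewrite normrM normfV normr_id divff ?gt_eqF.
have [t1|t1] := ltP `|f n| 1; last first.
  exists n, (f n); have := normr_ge0 (f - f n *: l1_unit n); split.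
    by apply/le_anti; rewrite t1 andbT (le_trans (l1_coord_le f n)).
  by apply/eqP; rewrite -subr_eq0 -normr_le0; move: fs f1 t1; lra.
exists n, (f n / `|f n|); split=> //; apply/esym.
have t1' : 0 < 1 - `|f n| by rewrite subr_gt0.
have [||||//] := fext ((f n / `|f n|) *: l1_unit n)
  ((1 - `|f n|)^-1 *: (f - f n *: l1_unit n)) `|f n|.
- by rewrite /= normrZ s1 l1_norm_unit mulr1.
- rewrite /= normrZ gtr0_norm ?invr_gt0// ler_pdivrMl// mulr1.
  by move: f1; rewrite fs; lra.
- by rewrite t0 t1.
by rewrite !scalerA -sE divff ?gt_eqF// scale1r addrC subrK.
Qed.

(** The functional [s * f n] is at most 1 on the ball, with equality only at this point. *)
Lemma l1_unit_ball_extreme n (s : R) : `|s| = 1 ->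
  extreme_points [set f : l1 R | `|f| <= 1] (s *: l1_unit n).
Proof.
move=> s1; split; first by rewrite /= normrZ s1 l1_norm_unit mulr1.
have ss := sqr_norm1 s1.
have coord_unit f : `|f| <= 1 -> s * f n = 1 -> f = s *: l1_unit n.
  move=> f1 sf; have fE : f n = s by rewrite -[LHS]mul1r -ss -mulrA sf mulr1.
  apply/eqP; rewrite -subr_eq0 -normr_le0; have := l1_norm_split f n.
  by rewrite fE s1; move: f1; lra.
have le1 f : `|f| <= 1 -> s * f n <= 1.
  move=> f1; apply: le_trans (ler_norm _) _; rewrite normrM s1 mul1r.
  exact: le_trans (l1_coord_le _ _) f1.
move=> y z t /= y1 z1 /andP[t0 t1] yz.
have := congr1 (fun f : l1 R => s * f n) yz; rewrite /= => E.
have {}E : 1 = t * (s * y n) + (1 - t) * (s * z n).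
  have -> : t * (s * y n) + (1 - t) * (s * z n) = s * (t *: y + (1 - t) *: z) n.
    by rewrite l1_coordD !l1_coordZ; ring.
  by rewrite -yz l1_coordZ l1_unitE eqxx mulr1 ss.
have t1' : 0 < 1 - t by rewrite subr_gt0.
have hy : t * (s * y n) <= t * 1 by rewrite ler_pM2l// le1.
have hz : (1 - t) * (s * z n) <= (1 - t) * 1 by rewrite ler_pM2l// le1.
split; apply: coord_unit => //; apply/le_anti; rewrite le1//=.
  by rewrite -(ler_pM2l t0); lra.
by rewrite -(ler_pM2l t1'); lra.
Qed.

Lemma weak_star_eval_continuous x :
  continuous (fun f : weak_star iota => iota f x : R^o).
Proof.
move=> f; apply: (@continuous_comp (weak_star iota) {ptws X -> R} R
  (fun f : l1 R => iota f : X -> R) (@^~ x)).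
  exact: initial_continuous.
exact: (@proj_continuous X (fun=> R) x).
Qed.

Lemma weak_star_nbhs_eval g x (e : R) : 0 < e ->
  nbhs (g : weak_star iota) [set f | `|iota g x - iota f x| < e].
Proof.
by move=> e0; have /cvgrPdist_lt := @weak_star_eval_continuous x g; exact.
Qed.

(** Points other than [g] are separated from it by evaluation at some [x]; the alternative [f = g]
    allows for [g] in [P]. *)
Lemma weak_star_nbhs_avoid g (P : seq (l1 R)) :
  nbhs (g : weak_star iota) [set f | f = g \/ f \notin P].
Proof.
have FF : Filter (nbhs (g : weak_star iota)) := nbhs_filter _.
elim: P => [|p P IHP]; first by apply: filterS filterT => f _; right.
have [pg|pg] := eqVneq p g.
  apply: filterS IHP => f /= [->|fP]; first by left.
  by have [->|fp] := eqVneq f p; [left|right; rewrite inE negb_or fp].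
have [x px] : exists x, iota p x != iota g x.
  apply: contrapT => /forallNP h; move/eqP: pg; apply; apply: iota_inj => x.
  by apply/eqP; apply: contrapT => /negP; exact: h.
have d0 : 0 < `|iota g x - iota p x| by rewrite normr_gt0 subr_eq0 eq_sym.
apply: filterS2 IHP (weak_star_nbhs_eval g x d0) => f /= [->|fP] fx;
  first by left.
right; rewrite inE negb_or fP andbT; apply/eqP => fp.
by rewrite fp ltxx in fx.
Qed.

(** Every neighbourhood of [g] meets the signed unit vectors, even after removal of the finitely
    many with index in [t]. *)
Lemma weak_star_derived_coord g x (e : R) (t : seq nat) : 0 < e ->
  weak_star_derived iota (extreme_points [set f : l1 R | `|f| <= 1]) g ->
  exists n (s : R), [/\ n \notin t, `|s| = 1 & `|iota g x - s * coord n x| < e].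
Proof.
move=> e0 gder.
pose P : seq (l1 R) := [seq l1_unit n | n <- t] ++ [seq - l1_unit n | n <- t].
have FF : Filter (nbhs (g : weak_star iota)) := nbhs_filter _.
have := @filterI _ _ FF _ _ (weak_star_nbhs_avoid g P)
  (weak_star_nbhs_eval g x e0).
move=> /gder[f [/eqP fg /l1_ball_extreme_unit[n [s [s1 fE]]] [fP fx]]].
exists n, s; split=> //; last by rewrite /coord -iotaZ -fE.
case: fP => // fP; apply/negP => nt; move/negP: fP; apply.
rewrite /P mem_cat; move: s1; have [s0|s0] := leP 0 s.
  rewrite ger0_norm// => s1; rewrite fE s1 scale1r.
  by apply/orP; left; exact: map_f.
rewrite ltr0_norm// => s1; rewrite fE -[s]opprK s1 scaleN1r.
by apply/orP; right; exact: (map_f (fun n => - l1_unit n)).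
Qed.

Lemma iota_support_ext g x y : (forall n, g n != 0 -> coord n x = coord n y) ->
  iota g x = iota g y.
Proof.
move=> gxy; rewrite -(cvg_lim (@Rhausdorff R) (@iota_cvg g x)).
rewrite -(cvg_lim (@Rhausdorff R) (@iota_cvg g y)).
congr (limn _); apply/funext => n; apply: eq_bigr => i _.
by have [->|gi] := eqVneq (g i) 0; rewrite ?mul0r// gxy.
Qed.

(** A state holds the indices used so far and the current vector. Each step adds an index of modulus
    1, freezes the earlier values and moves the vector by at most [2^-1 ^+ k]; the limit keeps all
    the values. *)
Lemma norming_sequence (P : seq nat * X -> Prop) st0 : P st0 ->
  (forall (k : nat) st, P st -> exists n y, [/\ n \notin st.1, `|coord n y| = 1,
     forall m, m \in st.1 -> coord m y = coord m st.2,
     `|y - st.2| <= 2^-1 ^+ k /\ `|y| <= 1 & P (n :: st.1, y)]) ->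
  exists x0 (j : nat -> nat),
    [/\ `|x0| <= 1, injective j & forall k, `|coord (j k) x0| = 1].
Proof.
move=> P0 PS.
have [//|k st /(PS k)[n [y [nt ny yst [yk y1] Py]]]|st [_ stP stS]] :=
  @sequence_choice _ (fun=> P) (fun k st st' => exists n, [/\ st'.1 = n :: st.1,
     n \notin st.1, `|coord n st'.2| = 1,
     forall m, m \in st.1 -> coord m st'.2 = coord m st.2 &
     `|st'.2 - st.2| <= 1 * 2^-1 ^+ k /\ `|st'.2| <= 1]) st0.
  by exists (n :: st.1, y) => //; exists n; split; rewrite // mul1r.
have /choice[j jP] := stS.
have /cvg_ex[x0 cx] : cvgn (fun k => (st k).2).
  apply: (@cvgn_geometric_step R X _ 1) => k.
  by have [_ _ _ _ []] := jP k.
have jst k l : (k < l)%N -> j k \in (st l).1.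
  elim: l => // l IHl; rewrite ltnS leq_eqVlt => /predU1P[->|kl].
    by have [-> _ _ _ _] := jP l; rewrite inE eqxx.
  by have [-> _ _ _ _] := jP l; rewrite inE IHl ?orbT.
have jl k l : coord (j k) (st (k.+1 + l)%N).2 = coord (j k) (st k.+1).2.
  elim: l => [|l IHl]; first by rewrite addn0.
  have [_ _ _ fix_j _] := jP (k.+1 + l)%N; rewrite addnS fix_j//.
  by apply: jst; rewrite leq_addr.
exists x0, j; split.
- have cn : (fun k => `|(st k.+1).2|) @ \oo --> `|x0|.
    by apply: cvg_norm; rewrite (cvg_shiftS (fun k => (st k).2)).
  rewrite -(cvg_lim (@Rhausdorff R) cn); apply: limr_le.
    by apply/cvg_ex; eexists; exact: cn.
  by apply: nearW => k; have [_ _ _ _ []] := jP k.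
- have lt k l : (k < l)%N -> j k != j l.
    move=> /jst kl; have [_ jl' _ _ _] := jP l.
    by apply: contraNneq jl' => <-.
  move=> k l kl; apply/eqP; case: (ltngtP k l) => // h; have := lt _ _ h.
    by rewrite kl eqxx.
  by rewrite kl eqxx.
move=> k; have <- : coord (j k) (st k.+1).2 = coord (j k) x0.
  apply/eqP; rewrite -subr_eq0 -coordB -normr_le0; apply/ler_addgt0Pr => e e0.
  move/cvgrPdist_le : cx => /(_ _ e0)[N _ cN]; rewrite add0r.
  have := cN (k.+1 + N)%N (leq_addl _ _); rewrite distrC => h.
  by rewrite coordB -(jl k N) -coordB (le_trans (coord_le _ _)).
by have [_ _ ? _ _] := jP k.
Qed.

Lemma weak_star_derived_norming g x : `|g| <= 1 -> `|x| = 1 -> iota g x = 1 ->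
  weak_star_derived iota (extreme_points [set f : l1 R | `|f| <= 1]) g ->
  exists x0 (j : nat -> nat),
    [/\ `|x0| <= 1, injective j & forall k, `|coord (j k) x0| = 1].
Proof.
move=> g1 x1 gx gder.
have [[s sP]|inf] := pselect (exists s : seq nat,
    forall n, `|coord n x| = 1 -> n \in s); last first.
  (* Infinitely many coordinates have modulus 1 at [x], so the vector need not move. *)
  apply: (@norming_sequence (fun st => st.2 = x) ([::], x)) => // k st ->.
  have [n nx nst] : exists2 n, `|coord n x| = 1 & n \notin st.1.
    apply: contrapT => /forall2NP h; apply: inf; exists st.1 => n nx.
    by have [//|/negP/negPn] := h n.
  by exists n, x; split=> //; rewrite subrr normr0 x1.
(* Since [g] norms [x], the coordinates in its support have modulus 1 at [x]; keeping the values on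
   [s] thus preserves the value of [g]. *)
have gs n : g n != 0 -> n \in s.
  move=> gn; apply: sP; have gxx : iota g x = `|x| by rewrite gx x1.
  have := norming_coord n g1 gxx; rewrite x1 mulr1 => /(congr1 Num.norm);
    rewrite normrM normr_id => /eqP.
  by rewrite -{2}[`|g n|]mulr1 => /eqP/mulfI; apply; rewrite normr_eq0.
apply: (@norming_sequence (fun st => [/\ {subset s <= st.1}, `|st.2| <= 1 &
  forall n, n \in s -> coord n st.2 = coord n x]) (s, x)).
  by split=> [n||]; rewrite ?x1.
move=> k [t y] /= [st y1 ys].
have gy : iota g y = 1 by rewrite -gx; apply: iota_support_ext => n /gs/ys.
have e0 : 0 < (2^-1 : R) ^+ k by rewrite exprn_gt0// invr_gt0.
have [n [sg [nt sg1 sgn]]] := weak_star_derived_coord y t e0 gder.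
(* The ball around 0 keeps the norm at most 1, the one around [y] makes the move small; [v] freezes
   the coordinates in [t] and sets the new one to a sign. *)
pose c (b : bool) := if b then 0 else y.
pose r (b : bool) : R := if b then 1 else 2^-1 ^+ k.
pose v i := if i == n then sg else coord i y.
have [||y' y's y'c] := @ball_intersection _ c r (n :: t) v.
- have := normr_ge0 y; move: y1 e0.
  by move=> h1 h2 h3 [] []; rewrite /= ?subrr ?normr0 ?sub0r ?normrN ?subr0;
    lra.
- move=> i b; rewrite inE /v; case: eqP => [-> _|_ /= it]; case: b => /=.
  + by rewrite coord0 subr0 sg1.
  + rewrite -[leLHS]mul1r -{1}sg1 -normrM mulrBr sqr_norm1//.
    by move: sgn; rewrite gy => /ltW.
  + by rewrite coord0 subr0 (le_trans (coord_le _ _)).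
  + by rewrite subrr normr0 ltW.
have y'E m : m \in t -> coord m y' = coord m y.
  move=> mt; rewrite y's ?inE ?mt ?orbT// /v.
  by case: eqP => // mn; rewrite mn (negPf nt) in mt.
exists n, y'; split=> //.
- by rewrite y's ?mem_head// /v eqxx.
- by split; [exact: (y'c false)|have := y'c true; rewrite subr0].
- split=> [m /st mt||m ms]; first by rewrite inE mt orbT.
    by have := y'c true; rewrite subr0.
  by rewrite y'E ?ys//; exact: st.
Qed.

Lemma copy_of_weak_star_derived g x : `|g| = 1 -> `|x| = 1 -> `|iota g x| = 1 ->
  weak_star_derived iota (extreme_points [set f : l1 R | `|f| <= 1]) g ->
  exists S : choquet_simplex R, ~ finite_dimensional (affine_space S) /\
    contains_isometric_copy X (affine_space S).
Proof.
move=> g1 x1 gx gder.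
have [x' [x'1 gx']] : exists x', `|x'| = 1 /\ iota g x' = 1.
  have [h|h] := leP 0 (iota g x).
    by exists x; split=> //; rewrite -gx ger0_norm.
  by exists (- x); split; [rewrite normrN|rewrite linearN /= -gx ltr0_norm].
have g1' : `|g| <= 1 by rewrite g1.
have [x0 [j [x0le1 jinj jx]]] := weak_star_derived_norming g1' x'1 gx' gder.
have [a [u tower]] := @peaked_partition_tower j (fun k => coord (j k) x0) x0
  jinj (fun k => sqr_norm1 (jx k)) x0le1 (fun k => sqr_norm1 (jx k)).
exact: linfty_tower_copy tower.
Qed.

(** An ultrafilter finer than the sequence converges pointwise in a product of segments; the limit
    is linear and bounded, hence represented by some [g]. *)
Lemma weak_star_limit_point (d : nat -> l1 R) : injective d ->
  (forall k, `|d k| <= 1) -> exists g, [/\ `|g| <= 1,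
    forall x (c : R), (forall k, iota (d k) x = c) -> iota g x = c &
    forall A : set (l1 R), (forall k, A (d k)) -> weak_star_derived iota A g].
Proof.
move=> d_inj d1.
pose D k : {ptws X -> R^o} := iota (d k) : X -> R^o.
have DF : ProperFilter (D @ \oo) by exact: fmap_proper_filter.
have [G [GU FG]] := ultraFilterLemma DF.
have GD (P : set (X -> R^o)) : (forall k, P (iota (d k))) -> G P.
  by move=> Pd; apply: FG; exists 0%N => // k _; exact: Pd.
have := @tychonoff X (fun=> R^o) (fun x => `[- `|x|, `|x|]%classic)
  (fun x => @segment_compact _ _ _).
rewrite compact_ultra => /(_ G GU).
have dx k x : `|iota (d k) x| <= `|x|.
  by apply: le_trans (iota_le _ _) _; rewrite ler_piMl.
case.
  by apply: GD => k x; rewrite /= in_itv/= -ler_norml.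
move=> phi [/= phix Gphi].
have phic x : (fun h : X -> R^o => h x) @ G --> phi x.
  by move: x; apply/(@pointwise_cvgP X R^o G phi).
have phi_lin : linear (phi : X -> R^o).
  move=> a x y; have h1 := phic (a *: x + y).
  have h2 : (fun h : X -> R^o => a *: h x + h y) @ G --> a *: phi x + phi y.
    by apply: (@cvgD R R^o); [apply: (@cvgZr R R^o); exact: phic|exact: phic].
  have /near_eq_cvg h3 : \forall h \near G, (a *: h x + h y : R^o) =
    h (a *: x + y).
    by apply: GD => k; rewrite linearP.
  apply: (@cvg_unique R^o (@Rhausdorff R) _ _ _ _ h1).
  exact: cvg_trans h3 h2.
have phiB x : `|linear_of phi_lin x| <= 1 * `|x|.
  rewrite mul1r -[X in `|X|]/(phi x).
  by have := phix x; rewrite in_itv/= -ler_norml.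
have [g gE] := bounded_linear_iota phiB.
have gphi : (iota g : X -> R^o) = phi by apply/funext => x; rewrite gE.
exists g; split.
- rewrite -(iota_isom.1 g); apply: dual_norm_le => x x1.
  by rewrite gE (le_trans (phiB x))// mul1r.
- move=> x c dc; rewrite gE.
  have h1 := phic x.
  have h2 : (fun h : X -> R^o => h x) @ G --> (c : R^o).
    by apply: cvg_near_cst; apply: GD.
  exact: (@cvg_unique R^o (@Rhausdorff R) _ _ _ _ h1 h2).
move=> A Ad V [_ [[W oW <-] Wg WV]].
have GW : G W.
  have Wphi : nbhs (phi : {ptws X -> R}) W.
    by apply: open_nbhs_nbhs; split => //; rewrite -gphi.
  exact: Gphi Wphi.
(* By injectivity at most one [d k] equals [g], and a tail of the sequence avoids it. *)
have GN : G [set h | exists2 k, h = D k & d k != g].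
  apply: FG; have [[k0 dk0]|nd] := pselect (exists k, d k = g); last first.
    by exists 0%N => // k _; exists k => //; apply/eqP => dk; apply: nd;
      exists k.
  exists k0.+1 => // k /= kk0; exists k => //; apply/eqP => dk.
  by rewrite (d_inj k k0) ?ltnn// dk dk0 in kk0.
have [h [Wh [k hk dkg]]] := filter_ex (filterI GW GN).
exists (d k); split=> //; apply: WV => /=.
by rewrite -[X in W X]/(D k) -hk.
Qed.

(** * The constant function 1 in an isometric copy of [A(S)] *)

Section affine_copy.
Context {S : choquet_simplex R}.
Variable T : {linear affine_space S -> X}.
Hypothesis T_isom : isometric_embedding T.

Lemma affine_one_subproof : (fun=> 1 : R^o) \in affine_pred (S := S).
Proof.
rewrite inE; split=> [x y z t _ _|]; first by rewrite !mulr1 addrC subrK.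
exact: cst_continuous.
Qed.

Definition affine_one : affine_space S := Affine affine_one_subproof.

Lemma affine_one_norm : `|affine_one| = 1.
Proof.
apply/le_anti/andP; split; first by apply: affine_norm_le => x; rewrite normr1.
have [x _] := @choquet_simplex_point _ S.
by have := affine_apply_le affine_one x; rewrite normr1.
Qed.

(* For [h >= 0] the norm of [1 + h] is [1 + |h|], so it is attained at a
   coordinate where the unit [T 1] has absolute value 1. *)
Lemma norming_unit_coords_le0 (s : seq nat) (f : affine_space S) :
  (forall n, `|coord n (T affine_one)| = 1 -> n \in s) ->
  (forall n, n \in s -> coord n (T f) = 0) -> forall p, f p <= 0.
Proof.
move=> sP f0 p; pose M := `|f|.
(* Adding the constant [M] makes the function nonnegative; it remains to see that its norm is at
   most [M]. *)
pose h := M *: affine_one + f.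
have hE q : h q = M + f q by rewrite -[LHS]/(M * 1 + f q) mulr1.
have h_ge0 q : 0 <= h q.
  by rewrite hE; have : `|f q| <= M := affine_apply_le f q;
    rewrite ler_norml => /andP[]; lra.
have h1 : `|h| <= `|affine_one + h| - 1.
  apply: affine_norm_le => q; rewrite ger0_norm// lerBrDl.
  by apply: le_trans (affine_apply_le _ q); exact: ler_norm.
have [n nh] := norm_attained (T (affine_one + h)).
rewrite T_isom linearD coordD in nh.
have c1 := coord_le n (T affine_one); rewrite T_isom affine_one_norm in c1.
have ch := coord_le n (T h); rewrite T_isom in ch.
have cD := ler_normD (coord n (T affine_one)) (coord n (T h)).
have n1 : `|coord n (T affine_one)| = 1 by lra.
(* Equality in the triangle inequality has put [n] into [s], where [f] contributes nothing. *)
have Th : coord n (T h) = M * coord n (T affine_one).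
  by rewrite linearD linearZ/= coordD coordZ f0 ?addr0// sP.
have cM : `|coord n (T h)| = M by rewrite Th normrM n1 mulr1 normr_id.
have : `|h| <= M by lra.
by have := affine_apply_le h p; rewrite hE ger0_norm -?hE// hE; lra.
Qed.

(** If all coordinates of modulus 1 at [T affine_one] were in a finite list, any [f] whose image
    vanishes on that list would satisfy [f <= 0] and [- f <= 0], and finitely many forms would
    separate points. *)
Lemma affine_copy_norming : ~ finite_dimensional (affine_space S) ->
  exists x0 (j : nat -> nat), [/\ `|x0| <= 1, injective j &
    forall k, `|coord (j k) x0| = 1].
Proof.
move=> infd; apply: (@norming_sequence (fun st => st.2 = T affine_one)
  ([::], T affine_one)) => // k [t y] /= ->.
have [n n1 nt] : exists2 n, `|coord n (T affine_one)| = 1 & n \notin t.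
  apply: contrapT => /forall2NP h; apply: infd.
  have tP n : `|coord n (T affine_one)| = 1 -> n \in t.
    by move=> n1; have [//|/negP/negPn] := h n.
  have Tlin n : linear (fun f : affine_space S => coord n (T f)).
    by move=> a u v; rewrite !linearP.
  apply: (@finite_dimensional_of_forms _ _ (fun n => linear_of (Tlin n)) t).
  move=> f f0; apply/val_inj/funext => x; apply/le_anti/andP; split.
    exact: norming_unit_coords_le0 tP f0 x.
  rewrite -oppr_le0; apply: (norming_unit_coords_le0 (f := - f) tP) => n /f0 fn.
  by rewrite linearN coordN [X in - X]fn oppr0.
by exists n, (T affine_one); split; rewrite // subrr normr0 T_isom
  affine_one_norm.
Qed.

End affine_copy.

(** The sign attached to each unit vector makes its value at [x0] equal to 1. The cluster point
    inherits this value, which forces both norms to be 1. *)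
Lemma weak_star_derived_of_norming x0 (j : nat -> nat) : `|x0| <= 1 ->
  injective j -> (forall k, `|coord (j k) x0| = 1) -> exists g x,
  [/\ weak_star_derived iota (extreme_points [set f : l1 R | `|f| <= 1]) g,
      `|x| = 1, `|iota g x| = `|g| & `|g| = 1].
Proof.
move=> x0le1 jinj jx; pose d k := coord (j k) x0 *: l1_unit (j k).
have dinj : injective d.
  move=> k l kl; apply: jinj; apply/eqP; apply: contrapT => /negP/negPf jkl.
  have := congr1 (fun f : l1 R => f (j k)) kl.
  rewrite /d !l1_coordZ !l1_unitE eqxx jkl mulr1 mulr0 => h.
  by have := jx k; rewrite h normr0 => /esym/eqP; rewrite oner_eq0.
have d1 k : `|d k| <= 1 by rewrite normrZ jx l1_norm_unit mulr1.
have [g [g1 gc gder]] := weak_star_limit_point dinj d1.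
have gx : iota g x0 = 1.
  by apply: gc => k; rewrite iotaZ -/(coord (j k) x0) sqr_norm1.
have := iota_le g x0; rewrite gx normr1 => h.
have gn : `|g| = 1.
  apply/le_anti; rewrite g1/=; apply: le_trans h _.
  by rewrite ler_piMr.
have xn : `|x0| = 1 by apply/le_anti; rewrite x0le1/=; move: h;
  rewrite gn mul1r.
exists g, x0; split=> //; last by rewrite gx gn normr1.
by apply: gder => k; apply: l1_unit_ball_extreme.
Qed.

End predual.

Unset Implicit Arguments.

Theorem theorem6p9 (R : realType) (X : completeNormedModType R)
    (iota : {linear l1 R -> dual X}) (iota_isom : isometric_isomorphism iota) :
  (exists S : choquet_simplex R,
     ~ finite_dimensional (affine_space S) /\
     contains_isometric_copy X (affine_space S)) <->
  (exists (g : l1 R) (x : X),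
     [/\ weak_star_derived iota (extreme_points [set f : l1 R | `|f| <= 1]) g,
         `|x| = 1, `|iota g x| = `|g| & `|g| = 1]).
Proof.
split=> [[S [infd [T T_isom]]]|[g [x [gder x1 gx g1]]]].
  have [x0 [j [x0le1 jinj jx]]] := affine_copy_norming iota_isom T_isom infd.
  exact: (weak_star_derived_of_norming iota_isom x0le1 jinj jx).
by apply: (copy_of_weak_star_derived iota_isom g1 x1 _ gder); rewrite gx.
Qed.
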